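(* Let $(R,\mathfrak m,k)$ be a local ring and let $V$ be an $R$-module such that $\mathfrak m V=0$. If $R$ is singular and $\beta\colon M\to V$ is an $R$-linear map (from some $R$-module $M$) that factors through some $R$-module of finite projective dimension, then the induced map $\operatorname{Ext}^n_R(k,\beta)\colon \operatorname{Ext}^n_R(k,M)\to\operatorname{Ext}^n_R(k,V)$ satisfies $$\operatorname{Ext}^n_R(k,\beta)=0\quad\text{for all } n\in\mathbb Z.$$
   Context: A local ring $(R,\mathfrak m,k)$ is a commutative noetherian local ring $R$ with maximal ideal $\mathfrak m$ and residue field $k=R/\mathfrak m$. It is called singular when it is not a regular local ring. Modules are not assumed to be finitely generated. $\operatorname{Ext}^n=0$ for $n<0$. *)

(* Defs.v *)
From HB Require Import structures.
From mathcomp Require Import all_boot all_order all_algebra.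
From mathcomp Require Import mathcomp_extra boolp classical_sets functions.

Set Implicit Arguments.
Unset Strict Implicit.
Unset Printing Implicit Defensive.

Import GRing.Theory.
Local Open Scope ring_scope.
Local Open Scope quotient_scope.

(* Ideals are boolean predicates, as in [ring_quotient]; in the presence of
   [boolp] every ideal is of this form.  A [prime_idealr] and an [idealr] are
   proper ideals by definition, whereas [is_ideal] allows the unit ideal. *)

Section LocalRings.
Variable R : comNzRingType.

Definition is_ideal (I : {pred R}) : Prop := @GRing.submod_closed R R^o I.

Definition generates (s : seq R) (I : {pred R}) : Prop :=
  forall x : R,
    x \in I <-> exists c : 'I_(size s) -> R, x = \sum_(i < size s) c i * s`_i.

Definition noetherian : Prop :=
  forall I : {pred R}, is_ideal I -> exists s : seq R, generates s I.

Definition maximal_ideal (m : {pred R}) : Prop :=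
  idealr_closed m /\
  forall I : {pred R}, idealr_closed I -> {subset m <= I} -> {subset I <= m}.

Definition local_ring (m : {pred R}) : Prop :=
  [/\ noetherian, maximal_ideal m
    & forall I : {pred R}, maximal_ideal I -> I =i m].

(* p_0 < p_1 < ... < p_n : a chain with n strict inclusions *)
Definition prime_chain (n : nat) (p : 'I_n.+1 -> prime_idealr R) : Prop :=
  forall i j : 'I_n.+1, (i < j)%N ->
    {subset p i <= p j} /\ ~ {subset p j <= p i}.

Definition has_krull_dim (d : nat) : Prop :=
  (exists p : 'I_d.+1 -> prime_idealr R, prime_chain p) /\
  forall (n : nat) (p : 'I_n.+1 -> prime_idealr R), prime_chain p -> (n <= d)%N.

(* The maximal ideal can be generated by dim R elements. *)
Definition regular_local_ring (m : {pred R}) : Prop :=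
  local_ring m /\ exists s : seq R, generates s m /\ has_krull_dim (size s).

End LocalRings.

Section ResidueField.
Variables (R : comNzRingType) (m : idealr R).

Definition residue_field := {ideal_quot m}.

HB.instance Definition _ := GRing.ComNzRing.on residue_field.

Let qpi (a : R) : residue_field := \pi_{ideal_quot m} a.

Definition residue_scale (a : R) (x : residue_field) : residue_field := qpi a * x.

Fact residue_scaleA a b x :
  residue_scale a (residue_scale b x) = residue_scale (a * b) x.
Proof. by rewrite /residue_scale /qpi rmorphM mulrA. Qed.

Fact residue_scale1 : left_id 1 residue_scale.
Proof. by move=> x; rewrite /residue_scale /qpi rmorph1 mul1r. Qed.

Fact residue_scaleDr : right_distributive residue_scale +%R.
Proof. by move=> a x y; rewrite /residue_scale mulrDr. Qed.

Fact residue_scaleDl x : {morph residue_scale^~ x : a b / a + b}.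
Proof. by move=> a b; rewrite /residue_scale /qpi rmorphD mulrDl. Qed.

HB.instance Definition _ := GRing.Zmodule_isLmodule.Build R residue_field
  residue_scaleA residue_scale1 residue_scaleDr residue_scaleDl.

End ResidueField.

Section QuotientModule.
Variables (R : comNzRingType) (V : lmodType R) (S : submodClosed V).

(* Over a ring, closure under scaling by -1 makes S a subgroup. *)
Fact submod_zmod_closed : zmod_closed S.
Proof.
split=> [|v w Sv Sw]; first exact: rpred0.
by rewrite -scaleN1r rpredD // rpredZ.
Qed.

Definition submod_zmod : zmodClosed V :=
  HB.pack_for (zmodClosed V) (S : {pred V})
    (GRing.isZmodClosed.Build V (S : {pred V}) submod_zmod_closed).

Definition quot_module := Quotient.quot submod_zmod.

HB.instance Definition _ := GRing.Zmodule.on quot_module.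

Definition quot_class (v : V) : quot_module := \pi_(Quotient.quot submod_zmod) v.

Lemma quot_classP (v w : V) :
  quot_class v = quot_class w <-> v - w \in S.
Proof. by rewrite (Quotient.idealrBE submod_zmod); split => [/eqP | /eqP]. Qed.

Lemma quot_classD v w : quot_class (v + w) = quot_class v + quot_class w.
Proof. exact: (raddfD (\pi_(Quotient.quot submod_zmod))). Qed.

Lemma quot_class_repr (x : quot_module) : quot_class (repr x) = x.
Proof. exact: reprK. Qed.

Definition quot_scale (a : R) (x : quot_module) : quot_module :=
  quot_class (a *: repr x).

Lemma quot_scaleE a v : quot_scale a (quot_class v) = quot_class (a *: v).
Proof.
apply/quot_classP; rewrite -scalerBr rpredZ //.
by apply/quot_classP; rewrite quot_class_repr.
Qed.

Fact quot_scaleA a b x : quot_scale a (quot_scale b x) = quot_scale (a * b) x.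
Proof. by rewrite -[x]quot_class_repr !quot_scaleE scalerA. Qed.

Fact quot_scale1 : left_id 1 quot_scale.
Proof. by move=> x; rewrite -[x]quot_class_repr quot_scaleE scale1r. Qed.

Fact quot_scaleDr : right_distributive quot_scale +%R.
Proof.
move=> a x y; rewrite -[x]quot_class_repr -[y]quot_class_repr.
by rewrite -quot_classD !quot_scaleE scalerDr quot_classD.
Qed.

Fact quot_scaleDl x : {morph quot_scale^~ x : a b / a + b}.
Proof.
move=> a b; rewrite -[x]quot_class_repr !quot_scaleE.
by rewrite scalerDl quot_classD.
Qed.

HB.instance Definition _ := GRing.Zmodule_isLmodule.Build R quot_module
  quot_scaleA quot_scale1 quot_scaleDr quot_scaleDl.

Lemma quot_classZ a v : quot_class (a *: v) = a *: quot_class v.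
Proof. by rewrite -quot_scaleE. Qed.

End QuotientModule.

Section Resolutions.
Variable R : comNzRingType.

Definition projective (P : lmodType R) : Prop :=
  forall (A B : lmodType R) (g : {linear A -> B}) (f : {linear P -> B}),
    (forall b : B, exists a : A, g a = b) ->
    exists h : {linear P -> A}, forall x : P, g (h x) = f x.

Record proj_resolution (X : lmodType R) := ProjResolution {
  res_mod :> nat -> lmodType R;
  res_diff : forall n : nat, {linear res_mod n.+1 -> res_mod n};
  res_aug : {linear res_mod 0 -> X};
  res_projective : forall n : nat, projective (res_mod n);
  res_aug_surj : forall x : X, exists y : res_mod 0, res_aug y = x;
  res_exact0 : forall y : res_mod 0,
    res_aug y = 0 <-> exists z : res_mod 1, res_diff 0 z = y;
  res_exact : forall (n : nat) (y : res_mod n.+1),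
    res_diff n y = 0 <-> exists z : res_mod n.+2, res_diff n.+1 z = y
}.

Definition finite_proj_dim (X : lmodType R) : Prop :=
  exists (P : proj_resolution X) (N : nat),
    forall (n : nat), (N < n)%N -> forall x : P n, x = 0.

Definition factors_through_finite_proj_dim
    (M V : lmodType R) (beta : {linear M -> V}) : Prop :=
  exists (F : lmodType R) (f : {linear M -> F}) (g : {linear F -> V}),
    finite_proj_dim F /\ forall x : M, beta x = g (f x).

End Resolutions.

(* Ext^n_R(X, M) is the n-th cohomology of the complex Hom_R(P, M), for P a
   projective resolution of X. *)
Section Ext.
Variables (R : comNzRingType) (X : lmodType R) (P : proj_resolution X).

Section Cohomology.
Variables (M : lmodType R) (n : nat).

Definition is_cocycle : {pred P n -> M} :=
  fun f => `[< linear f /\ forall x : P n.+1, f (res_diff P n x) = 0 >].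

Fact is_cocycle_submod : GRing.subsemimod_closed is_cocycle.
Proof.
split; first split.
- by apply/asboolP; split=> // a x y; rewrite scaler0 addr0.
- move=> f g /asboolP[lf df] /asboolP[lg dg]; apply/asboolP.
  split=> [a x y|x].
    by rewrite !fctE lf lg scalerDr addrACA.
  by rewrite !fctE df dg addr0.
- move=> a f /asboolP[lf df]; apply/asboolP.
  split=> [b x y|x].
    by rewrite !fctE lf scalerDr !scalerA mulrC.
  by rewrite !fctE df scaler0.
Qed.

HB.instance Definition _ :=
  GRing.isSubmodClosed.Build R (P n -> M) is_cocycle is_cocycle_submod.

Record cocycle := Cocycle {
  cocycle_fun :> P n -> M;
  cocycleP : cocycle_fun \in is_cocycle
}.

HB.instance Definition _ := [isSub for cocycle_fun].
HB.instance Definition _ := [Choice of cocycle by <:].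
HB.instance Definition _ := [SubChoice_isSubLmodule of cocycle by <:].

End Cohomology.

(* In degree 0 the incoming differential of Hom_R(P, M) is zero. *)
Definition is_coboundary (M : lmodType R) (n : nat) : {pred cocycle M n} :=
  match n return {pred cocycle M n} with
  | 0 => fun f => `[< forall x : P 0, f x = 0 >]
  | n'.+1 => fun f => `[< exists g : {linear P n' -> M},
                            forall x : P n'.+1, f x = g (res_diff P n' x) >]
  end.

Fact is_coboundary_submod (M : lmodType R) (n : nat) :
  GRing.subsemimod_closed (@is_coboundary M n).
Proof.
case: n => [|n]; split; first split.
- by apply/asboolP.
- move=> f g /asboolP zf /asboolP zg; apply/asboolP=> x.
  by rewrite /= !fctE zf zg addr0.
- move=> a f /asboolP zf; apply/asboolP=> x.
  by rewrite /= !fctE zf scaler0.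
- split; first by apply/asboolP; exists \0.
  move=> f g /asboolP[f' ff'] /asboolP[g' gg']; apply/asboolP.
  by exists (f' \+ g') => x; rewrite /= !fctE ff' gg'.
- move=> a f /asboolP[f' ff']; apply/asboolP.
  by exists (a \*: f') => x; rewrite /= !fctE ff'.
Qed.

HB.instance Definition _ (M : lmodType R) (n : nat) :=
  GRing.isSubmodClosed.Build R (cocycle M n) (@is_coboundary M n)
    (is_coboundary_submod M n).

Definition ext_nat (n : nat) (M : lmodType R) : lmodType R :=
  quot_module (@is_coboundary M n).

Definition ext (n : int) (M : lmodType R) : lmodType R :=
  match n with
  | Posz n' => ext_nat n' M
  | Negz _ => 'rV[R]_0
  end.

Section Functoriality.
Variables (M V : lmodType R) (beta : {linear M -> V}).

Fact comp_cocycle_subproof (n : nat) (f : cocycle M n) :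
  beta \o f \in @is_cocycle V n.
Proof.
have /asboolP[lf df] := cocycleP f; apply/asboolP.
split=> [a x y|x] /=; first by rewrite lf linearP.
by rewrite df linear0.
Qed.

Definition comp_cocycle (n : nat) (f : cocycle M n) : cocycle V n :=
  Cocycle (comp_cocycle_subproof f).

Definition ext_nat_map (n : nat) (x : ext_nat n M) : ext_nat n V :=
  quot_class (@is_coboundary V n) (comp_cocycle (repr x)).

Lemma ext_nat_mapE (n : nat) (f : cocycle M n) :
  ext_nat_map (quot_class (@is_coboundary M n) f)
    = quot_class (@is_coboundary V n) (comp_cocycle f).
Proof.
apply/quot_classP.
have /quot_classP : quot_class (@is_coboundary M n)
    (repr (quot_class (@is_coboundary M n) f)) = quot_class (@is_coboundary M n) f.
  exact: quot_class_repr.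
move: (repr _) => h; case: n f h => [|n] f h /asboolP hf; apply/asboolP.
  move=> x; rewrite /= !fctE -linearB; have := hf x.
  by rewrite /= !fctE => ->; rewrite linear0.
have [g hg] := hf; exists (beta \o g) => x.
by rewrite /= !fctE -linearB -hg.
Qed.

Definition ext_map (n : int) : ext n M -> ext n V :=
  match n with
  | Posz n' => @ext_nat_map n'
  | Negz _ => fun=> 0
  end.

Fact ext_map_is_linear (n : int) : linear (@ext_map n).
Proof.
case: n => [n|n] a x y /=; last by rewrite scaler0 addr0.
rewrite -[x](@quot_class_repr _ _ (@is_coboundary M n)).
rewrite -[y](@quot_class_repr _ _ (@is_coboundary M n)).
rewrite -quot_classZ -quot_classD !ext_nat_mapE.
rewrite -quot_classZ -quot_classD.
congr quot_class; apply/val_inj/funext => z /=.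
by rewrite !fctE linearP.
Qed.

HB.instance Definition _ (n : int) :=
  GRing.isLinear.Build R (ext n M) (ext n V) *:%R (@ext_map n)
    (@ext_map_is_linear n).

End Functoriality.

End Ext.

Arguments ext_map {R X} P {M V} beta n x.

(* Main.v *)
Require Import Defs.
From HB Require Import structures.
From mathcomp Require Import all_boot all_order all_algebra.
From mathcomp Require Import zify.
From mathcomp Require Import boolp functions.

(** Let [A] be the minimal free resolution of the residue field [k], and let
    [f : A_n -> F] be a cocycle with values in a module of finite projective
    dimension.  A linear map from [F] to a module killed by [m] factors through
    [F / m F], so the theorem amounts to the inclusion of [f (A_n)] in [m F]: the
    map of degree [-n] from [Tor(k, k)] to [Tor(k, F)] induced by [f] on the
    second argument is zero on [Tor_n(k, k)].

    Assume that [A] has an endomorphism [theta] of degree -2 that is surjective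
    modulo [m].  It acts on [Tor(k, k)] and on [Tor(k, F)] through the first
    argument, hence commutes with [f].  A class of degree [n] is the image under
    [theta ^ l] of a class of degree [n + 2 l], which [f] sends to
    [Tor_(2l)(k, F)]; for [l] large this group is zero
    ([finite_proj_dim_tor_vanishes]), and the claim follows
    ([staircase_boundary], [cocycle_in_mM]).  The identification of the homology
    of [A (x) k] with that of [k (x) A] is made through cycles of [A (x) A], the
    staircases.

    The operator [theta] comes from the singularity of [R].  Let [x] be a minimal
    system of generators of [m] and [K] its Koszul complex.  If some syzygy [c] of
    [x] is nonzero in [H_1(K) (x) k], one adjoins to [K], following Tate, a divided
    power variable [Y] of degree 2 with [dY = sum_j c_j X_j].  The comparison
    theorem makes [K<Y>] act on [A] up to homotopy ([exists_tate_operators]), and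
    there is a [theta] that behaves as the derivation [d/dY]: modulo [m],
    [theta Y^(i+1) = Y^(i) + Y^(i+1) theta], a relation which has to be checked in
    total degree 2 only ([commutator_defect0]).  Then [theta] has the right inverse
    [sum_i (-1)^i Y^(i+1) theta^i] modulo [m] ([right_inverse_mod]).  Minimality
    matters: since all the differentials are zero modulo [m], liftings exist
    without conditions and homotopic maps are congruent ([lift_family],
    [family_in_ideal]).

    If there is no such [c], then all the syzygies of [x] are trivial by
    Nakayama's lemma, the generators form a regular sequence by rigidity of the
    Koszul complex ([koszul_rigid]), and the ideals generated by their initial
    segments form a chain of primes ([initial_ideal_prime]).  By Krull's height
    theorem ([prime_between], [prime_chain_size]) no chain is longer, so that [R]
    is regular ([regular_of_trivial_syzygies]). *)

Set Implicit Arguments.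
Unset Strict Implicit.
Unset Printing Implicit Defensive.

Import GRing.Theory.
Local Open Scope ring_scope.

(** * Submodules, noetherian modules and saturation *)

Lemma dependent_choice (T : nat -> Type) (P : forall n, T n -> Prop)
    (Q : forall n, T n -> T n.+1 -> Prop) (t0 : T 0) :
  P 0 t0 ->
  (forall n t, P n t -> exists t', P n.+1 t' /\ Q n t t') ->
  exists f : forall n, T n, f 0 = t0 /\ forall n, P n (f n) /\ Q n (f n) (f n.+1).
Proof.
move=> P0 step.
pose next n (t : {t | P n t}) : {t | P n.+1 t} :=
  let: exist t' h := cid (step n (sval t) (svalP t)) in exist _ t' h.1.
have nextQ n t : Q n (sval t) (sval (next n t)).
  by rewrite /next; case: cid => t' [].
pose f := nat_rect (fun n => {t : T n | P n t}) (exist _ t0 P0) next.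
exists (fun n => sval (f n)); split=> // n; split; first exact: svalP.
exact: nextQ.
Qed.

Section Submodules.
Variables (R : comNzRingType).

Definition submodule (M : lmodType R) (S : M -> Prop) : Prop :=
  S 0 /\ forall (a : R) x y, S x -> S y -> S (a *: x + y).

Definition span (M : lmodType R) (X : M -> Prop) (v : M) : Prop :=
  forall S, submodule S -> (forall x, X x -> S x) -> S v.

Definition noetherian_module (M : lmodType R) : Prop :=
  forall S : M -> Prop, submodule S ->
    exists s : seq M, forall x, S x <-> span (fun y => y \in s) x.

Section Basics.
Variables (M : lmodType R) (S : M -> Prop) (hS : submodule S).

Lemma submodule0 : S 0. Proof. exact: hS.1. Qed.

Lemma submoduleZ a x : S x -> S (a *: x).
Proof. by move=> Sx; rewrite -[_ *: _]addr0; apply: hS.2 => //; apply: hS.1. Qed.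

Lemma submoduleD x y : S x -> S y -> S (x + y).
Proof. by move=> Sx Sy; rewrite -[x]scale1r; apply: hS.2. Qed.

Lemma submoduleN x : S x -> S (- x).
Proof. by rewrite -scaleN1r; apply: submoduleZ. Qed.

Lemma submoduleB x y : S x -> S y -> S (x - y).
Proof. by move=> Sx /submoduleN; apply: submoduleD. Qed.

Lemma submodule_sum (I : Type) (r : seq I) (P : pred I) (F : I -> M) :
  (forall i, P i -> S (F i)) -> S (\sum_(i <- r | P i) F i).
Proof.
by move=> SF; elim/big_ind: _ => //; [exact: submodule0 | exact: submoduleD].
Qed.

End Basics.

Section Span.
Variables (M : lmodType R).

Lemma span_submodule (X : M -> Prop) : submodule (span X).
Proof.
split=> [S hS _|a x y hx hy S hS XS]; first exact: hS.1.
by apply: hS.2; [apply: hx | apply: hy].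
Qed.

Lemma span_in (X : M -> Prop) x : X x -> span X x.
Proof. by move=> Xx S _; apply. Qed.

Lemma span_seqP (s : seq M) x :
  span (fun y => y \in s) x <->
  exists c : 'I_(size s) -> R, x = \sum_(i < size s) c i *: s`_i.
Proof.
split=> [|[c ->]]; last first.
  apply: (submodule_sum (span_submodule _)) => i _.
  apply: (submoduleZ (span_submodule _)).
  by apply: span_in; rewrite mem_nth.
move/(_ (fun v => exists c : 'I_(size s) -> R, v = \sum_(i < size s) c i *: s`_i)).
apply; last first.
  move=> y ys; exists (fun i => (i == index y s :> nat)%:R).
  move: (ys); rewrite -index_mem => ltys.
  rewrite (bigD1 (Ordinal ltys)) //= eqxx scale1r nth_index // big1 ?addr0 //.
  by move=> i; rewrite -val_eqE /= => /negPf->; rewrite scale0r.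
split; first by exists (fun=> 0); rewrite big1 // => i _; rewrite scale0r.
move=> a _ _ [c ->] [c' ->]; exists (fun i => a * c i + c' i).
rewrite scaler_sumr -big_split /=; apply: eq_bigr => i _.
by rewrite scalerDl scalerA.
Qed.

(** The ascending chain condition in the form of a maximum principle: a
    strictly increasing chain of submodules would have a union without a
    finite generating set. *)
Lemma exists_maximal_submodule (Phi : (M -> Prop) -> Prop) (S0 : M -> Prop) :
  noetherian_module M -> (forall S, Phi S -> submodule S) -> Phi S0 ->
  exists S, [/\ Phi S, forall x, S0 x -> S x &
    forall S', Phi S' -> (forall x, S x -> S' x) -> forall x, S' x -> S x].
Proof.
move=> noethM Phi_sub Phi0; apply: contrapT => nomax.
have [||f [f0 hf]] := @dependent_choice (fun=> M -> Prop)
  (fun _ S => Phi S /\ forall x, S0 x -> S x)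
  (fun _ S S' => (forall x, S x -> S' x) /\ exists x, S' x /\ ~ S x) S0.
- by split.
- move=> _ S S_grows; apply: contrapT => noS'; apply: nomax; exists S.
  split; [exact: S_grows.1 | exact: S_grows.2 |].
  move=> S' PhiS' sub x S'x; apply: contrapT => nSx; apply: noS'; exists S'.
  split; split=> //; last by exists x.
  by move=> y /S_grows.2; apply: sub.
have mono n k x : f n x -> f (n + k)%N x.
  by elim: k => [|k IH] => [|/IH]; rewrite ?addn0 // addnS; apply: (hf _).2.1.
have sf n : submodule (f n) by apply/Phi_sub/(hf n).1.1.
pose U x := exists n, f n x.
have subU : submodule U.
  split=> [|a x y [n fx] [k fy]]; first by exists 0; apply: (sf 0).1.
  exists (n + k)%N; apply: (sf _).2; first exact: mono.
  by rewrite addnC; apply: mono.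
have [s sU] := noethM U subU.
have [N fN] : exists N, forall x, x \in s -> f N x.
  have : forall x, x \in s -> U x by move=> x xs; apply/sU; apply: span_in.
  elim: (s) => [|y t IH] Ut; first by exists 0.
  have [|N fN] := IH; first by move=> x xt; apply: Ut; rewrite inE xt orbT.
  have [k fk] := Ut y (mem_head _ _); exists (N + k)%N => x.
  rewrite inE => /predU1P[->|/fN]; last exact: mono.
  by rewrite addnC; apply: mono.
have [x [fx nfx]] := (hf N).2.2; apply: nfx.
have /sU : U x by exists N.+1.
by apply.
Qed.

End Span.

Lemma noetherian_extension (L M N : lmodType R) (i : {linear L -> M})
    (p : {linear M -> N}) :
  (forall x, p x = 0 -> exists y, i y = x) ->
  noetherian_module L -> noetherian_module N -> noetherian_module M.
Proof.
move=> ker_p noethL noethN S hS.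
have [|s hs] := noethL (fun y => S (i y)).
  split=> [|a x y Sx Sy]; first by rewrite linear0; apply: hS.1.
  by rewrite linearP; apply: hS.2.
have [|t ht] := noethN (fun z => exists x, S x /\ p x = z).
  split=> [|a _ _ [x [Sx <-]] [y [Sy <-]]].
    by exists 0; rewrite linear0; split=> //; apply: hS.1.
  by exists (a *: x + y); rewrite linearP; split=> //; apply: hS.2.
have [t' [St' pt']] : exists t', (forall x, x \in t' -> S x) /\ map p t' = t.
  have : forall z, z \in t -> exists x, S x /\ p x = z.
    by move=> z zt; apply/ht; apply: span_in.
  elim: (t) => [|z u IH] hu; first by exists [::].
  have [|u' [Su' <-]] := IH; first by move=> y yu; apply: hu; rewrite inE yu orbT.
  have [x [Sx <-]] := hu z (mem_head _ _); exists (x :: u'); split=> // y.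
  by rewrite inE => /predU1P[->|/Su'].
exists (map i s ++ t') => x; split=> [Sx T hT subT|]; last first.
  move/(_ S hS); apply=> y; rewrite mem_cat => /orP[/mapP[z zs ->]|/St' //].
  by apply/hs; apply: span_in.
have : span (fun z => z \in t) (p x) by apply/ht; exists x.
move/(_ (fun z => exists y, [/\ T y, S y & p y = z])) => [||y [Ty Sy pyx]].
- split=> [|a _ _ [y [Ty Sy <-]] [y' [Ty' Sy' <-]]].
    by exists 0; rewrite linear0; split=> //; [apply: hT.1 | apply: hS.1].
  by exists (a *: y + y'); rewrite linearP; split=> //; [apply: hT.2 | apply: hS.2].
- move=> z; rewrite -pt' => /mapP[y yt ->]; exists y; split=> //; last exact: St'.
  by apply: subT; rewrite mem_cat yt orbT.
have [|w iw] := ker_p (x - y); first by rewrite linearB /= pyx subrr.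
have : T (i w).
  have : span (fun z => z \in s) w by apply/hs; rewrite iw; apply: submoduleB.
  move/(_ (fun v => T (i v))); apply; first split=> [|a u v Tu Tv].
  - by rewrite linear0; apply: hT.1.
  - by rewrite linearP; apply: hT.2.
  - by move=> z zs; apply: subT; rewrite mem_cat map_f.
by rewrite iw => /submoduleD-/(_ hT _ Ty); rewrite subrK.
Qed.

End Submodules.

Section Saturation.
Variables (R : comNzRingType).

Definition ideal (I : R -> Prop) : Prop := submodule (M := R^o) I.

Definition prime_ideal (p : R -> Prop) : Prop :=
  [/\ ideal p, ~ p 1 & forall a b, p (a * b) -> p a \/ p b].

Definition adjoin (M : lmodType R) (S : M -> Prop) (g : M) (x : M) : Prop :=
  exists r y, S y /\ x = r *: g + y.

(** Inverse image of the localization of a submodule at the prime [p]. *)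
Definition saturation (p : R -> Prop) (M : lmodType R) (S : M -> Prop) (x : M) :=
  exists t, ~ p t /\ S (t *: x).

Definition saturated (p : R -> Prop) (M : lmodType R) (S : M -> Prop) : Prop :=
  forall x, saturation p S x -> S x.

Lemma idealP (I : R -> Prop) :
  I 0 -> (forall a x y, I x -> I y -> I (a * x + y)) -> ideal I.
Proof. by []. Qed.

Lemma ideal_mull (I : R -> Prop) a x : ideal I -> I x -> I (a * x).
Proof. by move=> hI; apply: (submoduleZ hI). Qed.

Lemma ideal_mulr (I : R -> Prop) a x : ideal I -> I x -> I (x * a).
Proof. by rewrite mulrC; apply: ideal_mull. Qed.

Lemma adjoin_submodule (M : lmodType R) (S : M -> Prop) g :
  submodule S -> submodule (adjoin S g).
Proof.
move=> hS; split=> [|a _ _ [r [y [Sy ->]]] [r' [y' [Sy' ->]]]].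
  by exists 0, 0; rewrite scale0r addr0; split=> //; apply: hS.1.
exists (a * r + r'), (a *: y + y'); split; first exact: hS.2.
by rewrite scalerDr scalerA scalerDl addrACA.
Qed.

Lemma adjoin_gen (M : lmodType R) (S : M -> Prop) g :
  submodule S -> adjoin S g g.
Proof. by move=> hS; exists 1, 0; rewrite scale1r addr0; split=> //; apply: hS.1. Qed.

Lemma adjoin_sub (M : lmodType R) (S : M -> Prop) g x : S x -> adjoin S g x.
Proof. by exists 0, x; rewrite scale0r add0r. Qed.

Section Prime.
Variables (p : R -> Prop) (hp : prime_ideal p).

Let ip : ideal p. Proof. by case: hp. Qed.

Lemma prime_notM t u : ~ p t -> ~ p u -> ~ p (t * u).
Proof. by case: hp => _ _ pM nt nu /pM[]. Qed.

Lemma prime_not1 : ~ p 1. Proof. by case: hp. Qed.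

Lemma prime_exp a n : p (a ^+ n) -> p a.
Proof.
by elim: n => [/prime_not1 //|n IH]; rewrite exprS; case: hp => _ _ pM /pM[].
Qed.

Lemma saturation_sub (M : lmodType R) (S : M -> Prop) x : S x -> saturation p S x.
Proof. by exists 1; rewrite scale1r; split=> //; apply: prime_not1. Qed.

Lemma saturation_submodule (M : lmodType R) (S : M -> Prop) :
  submodule S -> submodule (saturation p S).
Proof.
move=> hS; split=> [|a x y [t [nt Sx]] [u [nu Sy]]].
  by apply: saturation_sub; apply: hS.1.
exists (t * u); split; first exact: prime_notM.
rewrite scalerDr; apply: (submoduleD hS); last by rewrite -scalerA; apply: submoduleZ.
by rewrite scalerA -mulrA mulrC -scalerA; apply: submoduleZ.
Qed.

Lemma saturation_saturated (M : lmodType R) (S : M -> Prop) :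
  saturated p (saturation p S).
Proof.
move=> x [t [nt [u [nu Sx]]]]; exists (u * t); rewrite -scalerA; split=> //.
exact: prime_notM.
Qed.

Lemma prime_saturated (q : R -> Prop) :
  prime_ideal q -> (forall x, q x -> p x) -> saturated p (M := R^o) q.
Proof. by case=> _ _ qM qp x [t [nt /qM[/qp|]]]. Qed.

(** Nakayama's lemma for the localization at a prime.  It is proved without
    determinants: if [N] is maximal among the saturated submodules above [L]
    that do not contain [Z], then [(Z + N) / N] is simple locally at [p], so
    that [N] contains [p Z] and, by the hypothesis, [Z]. *)
Lemma nakayama (M : lmodType R) (L Z : M -> Prop) :
    noetherian_module M -> submodule L -> saturated p L ->
    (forall z, Z z -> saturation p
       (span (fun y => L y \/ exists a z', [/\ p a, Z z' & y = a *: z'])) z) ->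
  forall z, Z z -> L z.
Proof.
move=> noethM subL satL hZ z0 Zz0; apply: contrapT => nLz0.
pose Phi S := [/\ submodule S, saturated p S, forall x, L x -> S x
  & exists z, Z z /\ ~ S z].
have [||N [[subN satN LN [g [Zg nNg]]] _ maxN]] :=
  exists_maximal_submodule (Phi := Phi) (S0 := L) noethM.
- by move=> S [].
- by split=> //; exists z0.
have absorb h : ~ N h -> forall z, Z z -> saturation p (adjoin N h) z.
  move=> nNh z Zz; apply: contrapT => nz; apply: nNh.
  apply: (maxN (saturation p (adjoin N h))).
  - split; first exact/saturation_submodule/adjoin_submodule.
    + exact: saturation_saturated.
    + by move=> x /LN Nx; apply/saturation_sub/adjoin_sub.
    + by exists z.
  - by move=> x Nx; apply/saturation_sub/adjoin_sub.
  - exact/saturation_sub/adjoin_gen.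
have pg a : p a -> N (a *: g).
  move=> pa; apply: contrapT => /absorb/(_ g Zg)[t [nt [r [y [Ny tg]]]]].
  apply: nNg; apply: satN; exists (t - r * a); split; last first.
    by rewrite scalerBl tg scalerA addrAC subrr add0r.
  move=> pt; apply: nt; rewrite -[t](subrK (r * a)).
  by apply: (submoduleD ip) => //; apply: ideal_mull.
apply: (nNg); apply: (satN); have [t [nt]] := hZ g Zg; move/(_ N subN) => tg.
exists t; split=> //; apply: tg => y [/LN //|[a [z [pa Zz ->]]]].
apply: satN; have [u [nu [r [w [Nw uz]]]]] := absorb g nNg z Zz.
exists u; split=> //; rewrite scalerA mulrC -scalerA uz scalerDr.
apply: (submoduleD subN); last exact: submoduleZ.
by rewrite scalerA mulrC -scalerA; apply: submoduleZ => //; apply: pg.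
Qed.

End Prime.
End Saturation.

(** * Krull's height theorem *)

Section Krull.
Variables (R : comNzRingType) (noethR : noetherian_module R^o).
Implicit Types (I J p q : R -> Prop).

(** An ideal that is maximal among those avoiding a multiplicative set is prime. *)
Lemma exists_prime_avoiding I (S : R -> Prop) :
    ideal I -> S 1 -> (forall a b, S a -> S b -> S (a * b)) ->
    (forall x, I x -> ~ S x) ->
  exists q, [/\ prime_ideal q, forall x, I x -> q x & forall x, q x -> ~ S x].
Proof.
move=> hI S1 SM avoid.
pose Phi J := ideal J /\ forall x, J x -> ~ S x.
have [||q [[iq qS] Iq maxq]] :=
  exists_maximal_submodule (M := R^o) (Phi := Phi) (S0 := I) noethR.
- by move=> J [].
- by split.
exists q; split=> //; split=> // [/qS /(_ S1) //|a b qab].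
have meets c : ~ q c -> exists r y, q y /\ S (r * c + y).
  move=> nqc; apply: contrapT => noS; apply: nqc.
  apply: (maxq (adjoin (M := R^o) q c)); last exact: adjoin_gen.
    split; first exact: adjoin_submodule.
    by move=> _ [r [y [qy ->]]] Sx; apply: noS; exists r, y.
  by move=> x qx; apply: adjoin_sub.
apply: contrapT => /not_orP[/meets[r [y [qy Sa]]] /meets[s [z [qz Sb]]]].
apply: (qS _ _ (SM _ _ Sa Sb)).
rewrite mulrDl; apply: (submoduleD iq); last exact: ideal_mulr.
rewrite mulrDr; apply: (submoduleD iq); last exact: ideal_mull.
by rewrite mulrACA; apply: ideal_mull.
Qed.

(** The localization of [R / A] at [p] is artinian, since the elements of [p] are
    nilpotent modulo [A].  The ideals [J] on which the chain becomes
    stationary contain a maximal one; if it were proper, one could adjoin to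
    it an element [g] with [p g] inside [J], because over the residue field of
    [p] the line spanned by [g] has no proper nonzero subspace. *)
Lemma saturated_descending_chain (p A : R -> Prop) (I : nat -> R -> Prop) :
    prime_ideal p -> ideal A -> (forall x, p x -> exists n, A (x ^+ n)) ->
    (forall n, ideal (I n)) -> (forall n, saturated p (M := R^o) (I n)) ->
    (forall n x, A x -> I n x) -> (forall n x, I n.+1 x -> I n x) ->
  exists n, forall x, I n x -> I n.+1 x.
Proof.
move=> hp hA radA hI satI AI Idec.
have [ip p1 pM] := hp.
have Ile n k x : (n <= k)%N -> I k x -> I n x.
  by move/subnKC=> <-; elim: (k - n)%N => [|j IH]; rewrite ?addn0 // addnS => /Idec.
pose good J := [/\ ideal J, forall x, A x -> J x
  & exists n0, forall n x, (n0 <= n)%N -> I n x -> J x -> I n.+1 x].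
have [||J [[iJ AJ [n0 hn0]] _ maxJ]] :=
  exists_maximal_submodule (M := R^o) (Phi := good) (S0 := A) noethR.
- by move=> J [].
- by split=> //; exists 0 => n x _ _; apply: AI.
have satJ : saturated p (M := R^o) J.
  apply: maxJ => [|x Jx]; last exact: saturation_sub.
  split; first exact: saturation_submodule.
    by move=> x /AJ; apply: saturation_sub.
  exists n0 => n x len Inx [t [nt Jtx]]; apply: satI; exists t; split=> //.
  by apply: hn0 => //; apply: (submoduleZ (hI n)).
have [J1|nJ1] := pselect (J 1).
  exists n0 => x Ix; apply: hn0 => //.
  by rewrite -[x]mulr1; apply: ideal_mull.
(* An annihilator [J : g] that is maximal among those with [g] outside [J]. *)
pose quo g x := J (x * g).
have iquo g : ideal (quo g).
  apply: idealP => [|a x y]; rewrite /quo ?mul0r; first exact: iJ.1.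
  by move=> Jx Jy; rewrite mulrDl -mulrA; apply: iJ.2.
have [||_ [[g [nJg ->]] _ maxg]] := exists_maximal_submodule (M := R^o)
  (Phi := fun K => exists g, ~ J g /\ K = quo g) (S0 := quo 1) noethR.
- by move=> _ [g [_ ->]]; apply: iquo.
- by exists 1.
have pg x : p x -> J (x * g).
  move=> px; have [k Axk] := radA x px.
  have : J (x ^+ k * g) by apply: ideal_mulr => //; apply: AJ.
  elim: k {Axk} => [|k IH]; first by rewrite mul1r.
  have [/IH //|nJk] := pselect (J (x ^+ k * g)); rewrite exprS -mulrA => Jx.
  apply: (maxg (quo (x ^+ k * g))) => [|y Jyg|//]; first by exists (x ^+ k * g).
  by rewrite /quo mulrCA; apply: ideal_mull.
case: (nJg).
apply: (maxJ (adjoin (M := R^o) J g)) (adjoin_gen _ iJ) => [|x]; last exact: adjoin_sub.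
split; [exact: adjoin_submodule | by move=> x /AJ; apply: adjoin_sub |].
have [meets|] := pselect (forall n, exists c y, [/\ ~ p c, J y & I n (c * g + y)]).
  exists n0 => n x len Ix [e [z [Jz xE]]].
  have [c [y [nc Jy Iy]]] := meets n.+1.
  apply: satI; exists c; split=> //.
  have -> : c *: (x : R^o) = e *: ((c * g + y) : R^o) + (c * x - e * (c * g + y)).
    by rewrite addrC subrK.
  apply: (hI n.+1).2 => //; apply: hn0 => //.
    apply: (submoduleB (hI n)); first exact: ideal_mull.
    by apply: ideal_mull => //; apply: Idec.
  rewrite xE; have -> : c * (e *: (g : R^o) + z) - e * (c * g + y) = c * z - e * y.
    by rewrite !mulrDr mulrCA opprD addrACA subrr add0r.
  by apply: (submoduleB iJ); apply: ideal_mull.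
move=> /existsNP[n1 hn1]; exists (maxn n0 n1) => n x.
rewrite geq_max => /andP[len0 len1] Ix [c [y [Jy xE]]]; apply: hn0 => //.
have [pc|nc] := pselect (p c).
  by rewrite xE; apply: (submoduleD iJ) => //; apply: pg.
by case: hn1; exists c, y; split=> //; rewrite -[_ + _]xE; apply: Ile Ix.
Qed.

Definition strictly_below (p q : R -> Prop) : Prop :=
  (forall x, p x -> q x) /\ exists x, q x /\ ~ p x.

(** Krull's principal ideal theorem, in the form used on chains: if no prime
    strictly between [p0] and [p2] contains [x], then [p2] is minimal over
    [p0 + (x)], and the symbolic powers of [p1] modulo [p0] become stationary
    locally at [p2], which is absurd when [p0 < p1]. *)
Lemma prime_between (p0 p1 p2 : R -> Prop) x :
    prime_ideal p0 -> prime_ideal p1 -> prime_ideal p2 ->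
    strictly_below p0 p1 -> strictly_below p1 p2 -> p2 x ->
  exists q, [/\ prime_ideal q, strictly_below p0 q, strictly_below q p2 & q x].
Proof.
move=> hp0 hp1 hp2 [le01 [y [p1y np0y]]] [le12 [z [p2z np1z]]] p2x.
have [ip0 _ p0M] := hp0; have [ip1 n11 p1M] := hp1; have [ip2 n12 p2M] := hp2.
have [p1x|np1x] := pselect (p1 x).
  by exists p1; split=> //; split=> //; [exists y | exists z].
apply: contrapT => noq.
pose Ax := adjoin (M := R^o) p0 x.
have iAx : ideal Ax by apply: adjoin_submodule.
pose A : R -> Prop := saturation p2 (M := R^o) Ax.
have radA a : p2 a -> exists n, A (a ^+ n).
  move=> p2a; apply: contrapT => nA; apply: noq.
  have [|b c [n [t [nt ->]]] [k [u [nu ->]]]||q [hq Aq qS]] :=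
    exists_prime_avoiding (S := fun b => exists n t, ~ p2 t /\ b = t * a ^+ n) iAx.
  - by exists 0, 1; rewrite mulr1.
  - exists (n + k)%N, (t * u); rewrite exprD mulrACA; split=> //.
    exact: prime_notM.
  - move=> b Ab [n [t [nt bE]]]; apply: nA; exists n; exists t; split=> //.
    by rewrite -[_ *: _]bE.
  exists q; have qx : q x by apply: Aq; apply: adjoin_gen.
  split=> //; split.
  - by move=> b p0b; apply: Aq; apply: adjoin_sub.
  - by exists x; split=> // /le01.
  - move=> b qb; apply: contrapT => nb; apply: (qS b qb).
    by exists 0, b; rewrite mulr1.
  - exists a; split=> // /qS; apply; exists 1%N, 1; rewrite mul1r expr1; split=> //.
(* [J n] is the ideal [p1 ^ n + p0] and [sJ n] its [n]-th symbolic version. *)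
pose J := nat_rect (fun=> R -> Prop) (fun=> True) (fun _ (K : R -> Prop) =>
  span (M := R^o) (fun b => p0 b \/ exists a c, [/\ p1 a, K c & b = a *: (c : R^o)])).
pose sJ n := saturation p1 (M := R^o) (J n).
have iJ n : ideal (J n) by case: n => [|n]; [split=> *; exact: Logic.I | apply: span_submodule].
have isJ n : ideal (sJ n) := saturation_submodule hp1 (iJ n).
have p0J n b : p0 b -> J n b.
  by case: n => [|n] // p0b; apply: span_in; left.
have Jdec n b : J n.+1 b -> J n b.
  elim: n b => [|n IH] // b Jb; apply: (Jb (J n.+1) (iJ n.+1)).
  move=> e [p0e|[a [c [p1a Jc ->]]]]; first exact: p0J.
  by apply: span_in; right; exists a, c; split=> //; apply: IH.
have sJdec n b : sJ n.+1 b -> sJ n b.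
  by move=> [t [nt /Jdec Jb]]; exists t.
have satJ n : saturated p2 (M := R^o) (sJ n).
  move=> b [t [nt sb]]; apply: saturation_saturated => //; exists t.
  by split=> // /le12.
pose I n : R -> Prop := saturation p2 (M := R^o) (adjoin (M := R^o) (sJ n) x).
have [n hn] : exists n, forall b, I n b -> I n.+1 b.
  apply: (saturated_descending_chain hp2 _ radA).
  - exact: saturation_submodule.
  - by move=> n; apply: (saturation_submodule hp2); apply: (adjoin_submodule _ (isJ n)).
  - by move=> n; apply: (saturation_saturated hp2).
  - move=> n b [t [nt [r [c [p0c tb]]]]]; exists t; split=> //; exists r, c.
    by split=> //; apply: saturation_sub => //; apply: p0J.
  - move=> n b [t [nt [r [c [/sJdec sc tb]]]]]; exists t; split=> //.
    by exists r, c.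
have sJ_stable b : sJ n b -> sJ n.+1 b.
  apply: (nakayama hp2 noethR (isJ n.+1) (satJ n.+1)) => c sc.
  have [|t [nt [r [e [se tc]]]]] := hn c.
    by apply: saturation_sub => //; apply: adjoin_sub.
  exists t; split=> //; rewrite tc; apply: (submoduleD (span_submodule _)).
    apply: span_in; right; exists x, r; split=> //; last exact: (mulrC r x).
    apply: (saturation_saturated hp1); exists x; split=> //.
    have -> : x *: (r : R^o) = t *: (c : R^o) - e by rewrite tc addrK; exact: (mulrC x r).
    by apply: (submoduleB (isJ n)); [apply: (submoduleZ (isJ n)) | apply: sJdec].
  by apply: span_in; left.
have Jp0 : forall b, J n b -> p0 b.
  apply: (nakayama hp1 noethR ip0); first exact: prime_saturated.
  by move=> b Jb; apply: (sJ_stable b); apply: saturation_sub.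
apply: np0y; apply: (prime_exp hp0 (n := n)); apply: Jp0.
elim: (n) => [|k IH] //; rewrite exprS; apply: span_in; right.
by exists y, (y ^+ k).
Qed.

End Krull.

Section Chains.
Variables (R : comNzRingType) (noethR : noetherian_module R^o).
Variables (m : R -> Prop) (hm : prime_ideal m).
Hypothesis prime_le_m : forall p, prime_ideal p -> forall x, p x -> m x.

Fixpoint prime_chain_from (p : R -> Prop) (s : seq (R -> Prop)) : Prop :=
  if s is q :: s' then [/\ prime_ideal q, strictly_below p q & prime_chain_from q s']
  else True.

Lemma prime_chain_rcons p s q :
  prime_ideal q -> prime_chain_from p s -> strictly_below (last p s) q ->
  prime_chain_from p (rcons s q).
Proof. by move=> hq; elim: s p => [|r s IH] p //= [hr lt_pr /IH H] /H. Qed.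

Lemma prime_chain_last p s :
  prime_ideal p -> prime_chain_from p s -> prime_ideal (last p s).
Proof. by elim: s p => [|q s IH] p //= _ [hq _]; apply: IH. Qed.

(** Krull's theorem, applied from the top of the chain downwards, moves [x] into
    all the primes but the first at the cost of one prime. *)
Lemma prime_chain_through p q s x :
    prime_ideal p -> prime_chain_from p (q :: s) -> last q s x ->
  exists q' s', [/\ size s' = size s, prime_ideal q', strictly_below p q', q' x
    & prime_chain_from q' s'].
Proof.
elim: s p q => [|q2 s IH] p q hp /= [hq lt_pq]; first by exists q, [::].
move=> hqs lastx; have [q3 [s3 [sz hq3 lt_qq3 q3x hs3]]] := IH q q2 hq hqs lastx.
have [q4 [hq4 lt_pq4 lt_q43 q4x]] :=
  prime_between noethR hp hq hq3 lt_pq lt_qq3 q3x.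
by exists q4, (q3 :: s3); rewrite /= sz.
Qed.

(** The height theorem, by induction on the generators of [m] modulo [I]: a chain
    loses one prime when its members are made to contain one more generator. *)
Lemma prime_chain_size (xs : seq R) (I p : R -> Prop) (s : seq (R -> Prop)) :
    (forall x, x \in xs -> m x) ->
    (forall a, m a -> span (M := R^o) (fun b => I b \/ b \in xs) a) ->
    (forall x, I x -> p x) -> prime_ideal p -> prime_chain_from p s ->
  (size s <= size xs)%N.
Proof.
elim: xs I p s => [|x xs IH] I p [|q s] //= mxs genm Ip hp.
  move=> [hq [_ [b [qb npb]]] _]; case: npb; have [ip _ _] := hp.
  by apply: (genm b) => [|//|c [/Ip|]//]; apply: (prime_le_m hq).
have descend q' s' : prime_ideal q' -> strictly_below p q' -> q' x ->
    prime_chain_from q' s' -> (size s' <= size xs)%N.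
  move=> hq' [le_pq' _] q'x hs'.
  apply: (IH (fun b => I b \/ b = x) q') => // [y ys|a /genm ga|b [/Ip/le_pq'|->]//].
    by apply: mxs; rewrite inE ys orbT.
  move=> S hS subS; apply: ga => // b [Ib|]; first by apply: subS; left; left.
  by rewrite inE => /predU1P[->|bxs]; apply: subS; [left; right | right].
move=> hqs; have [lastx|nlastx] := pselect (last q s x).
  by have [q' [s' [<- hq' lt_pq' q'x]]] := prime_chain_through hp hqs lastx; apply: descend.
have mx : m x by apply: mxs; apply: mem_head.
have hqsm : prime_chain_from p (q :: rcons s m).
  apply: (@prime_chain_rcons p (q :: s)) => //; split; last by exists x.
  by apply: prime_le_m; apply: (@prime_chain_last p (q :: s)).
have [|q' [s' [sz hq' lt_pq' q'x hs']]] := prime_chain_through (x := x) hp hqsm.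
  by rewrite last_rcons.
rewrite size_rcons in sz.
by apply: leq_trans (descend _ _ hq' lt_pq' q'x hs'); rewrite sz.
Qed.

End Chains.

(** * Local rings *)

Section LocalRing.
Variables (R : comNzRingType) (m : {pred R}) (hR : local_ring m).

Lemma local_noetherian : noetherian_module R^o.
Proof.
have [noeth _ _] := hR; move=> S hS.
have [|s hs] := noeth (fun x => `[<S x>]).
  split=> [|a x y /asboolP Sx /asboolP Sy]; apply/asboolP; first exact: hS.1.
  exact: hS.2.
exists s => x; split=> [/asboolP/hs h|/span_seqP h]; first exact/span_seqP.
exact/asboolP/hs.
Qed.

Lemma local_ideal : ideal (fun x => x \in m).
Proof. by have [_ [[m0 _ mD] _] _] := hR; split=> // a x y; apply: mD. Qed.

Lemma local_not1 : 1 \notin m.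
Proof. by have [_ [[_ m1 _] _] _] := hR. Qed.

(** A proper ideal lies in a maximal one, and [m] is the only one. *)
Lemma proper_ideal_le_m (I : R -> Prop) :
  ideal I -> ~ I 1 -> forall x, I x -> x \in m.
Proof.
move=> hI nI1.
have [||J [[hJ nJ1] IJ maxJ]] := exists_maximal_submodule (M := R^o)
  (Phi := fun J => ideal J /\ ~ J 1) (S0 := I) local_noetherian.
- by move=> J [].
- by split.
pose J' : {pred R} := fun x => `[<J x>].
have [_ _ uniq_m] := hR.
have J'm : J' =i m.
  apply: uniq_m; split.
    split=> [||a x y /asboolP Jx /asboolP Jy]; try apply/asboolP.
    - exact: hJ.1.
    - exact: nJ1.
    - exact: hJ.2.
  move=> K [K0 K1 KD] J'K x Kx; apply/asboolP.
  apply: (maxJ (fun y => y \in K)) => // [|y Jy].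
    split; last by move=> K1'; rewrite K1' in K1.
    by split=> // a y z; apply: KD.
  by apply: J'K; apply/asboolP.
by move=> x /IJ Jx; rewrite -J'm; apply/asboolP.
Qed.

Lemma local_unit a : a \notin m -> exists b, a * b = 1.
Proof.
move=> nma; apply: contrapT => nunit; move/negP: nma; apply.
apply: (@proper_ideal_le_m (fun x => exists b, x = a * b)); last by exists 1; rewrite mulr1.
  apply: idealP => [|c _ _ [b ->] [b' ->]]; first by exists 0; rewrite mulr0.
  by exists (c * b + b'); rewrite mulrDr mulrCA.
by case=> b /esym ab1; apply: nunit; exists b.
Qed.

Lemma local_prime : prime_ideal (fun x => x \in m).
Proof.
split; [exact: local_ideal | exact/negP/local_not1 | move=> a b mab].
have [ma|/local_unit[a' aa']] := boolP (a \in m); first by left.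
by right; rewrite -[b]mulr1 -aa' mulrCA mulrA; apply: (ideal_mulr a' local_ideal mab).
Qed.

Lemma prime_le_local p : prime_ideal p -> forall x, p x -> x \in m.
Proof. by case=> ip np1 _; apply: proper_ideal_le_m. Qed.

Lemma local_unit_1B a : a \in m -> exists b, (1 - a) * b = 1.
Proof.
move=> ma; apply: local_unit; apply: contraNN local_not1 => mB.
by rewrite -(subrK a 1); apply: (submoduleD local_ideal).
Qed.

Lemma submodule_saturated (M : lmodType R) (S : M -> Prop) :
  submodule S -> saturated (fun x => x \in m) S.
Proof.
move=> hS x [t [/negP/local_unit[u tu1] Stx]].
by rewrite -[x]scale1r -tu1 mulrC -scalerA; apply: submoduleZ.
Qed.

Lemma rV_noetherian n : noetherian_module 'rV[R]_n.
Proof.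
elim: n => [|n IH].
  move=> S hS; exists [::] => x; split=> _.
    by rewrite thinmx0; apply: (span_submodule _).1.
  by rewrite thinmx0; apply: hS.1.
pose i (v : 'rV[R]_n) : 'rV[R]_n.+1 := row_mx (0 : 'rV_1) v.
have il : linear i.
  move=> a u v; apply/rowP => j; rewrite !mxE.
  by case: splitP => k _; rewrite !mxE ?mulr0 ?addr0.
pose p (v : 'rV[R]_n.+1) : R^o := v 0 0.
have pl : linear p by move=> a u v; rewrite /p !mxE.
pose iL := HB.pack_for {linear 'rV[R]_n -> 'rV[R]_n.+1} i
  (GRing.isLinear.Build R _ _ _ i il).
pose pL := HB.pack_for {linear 'rV[R]_n.+1 -> R^o} p
  (GRing.isLinear.Build R _ _ _ p pl).
apply: (noetherian_extension (i := iL) (p := pL)) => //; last exact: local_noetherian.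
move=> x /= px0; exists (@rsubmx R 1 1 n x).
rewrite -[RHS](@hsubmxK R 1 1 n x).
apply: (congr1 (fun u : 'rV_1 => row_mx u (@rsubmx R 1 1 n x))).
apply/rowP => j; rewrite !mxE ord1 -[LHS]px0; congr (x 0 _).
exact/val_inj.
Qed.

End LocalRing.

(** * Trivial syzygies and regular local rings *)

Section PrimeQuotient.
Variables (R : comNzRingType) (m : {pred R}) (hR : local_ring m).

(** A zero divisor [a] modulo [I] would be divisible by [x] modulo [I], and
    [a / x] would again be a zero divisor and generate a larger ideal. *)
Lemma prime_ideal_of_adjoin (I : R -> Prop) x :
    ideal I -> x \in m -> (forall b, I (x * b) -> I b) ->
    prime_ideal (adjoin (M := R^o) I x) ->
  prime_ideal I.
Proof.
move=> iI mx xreg [iJ nJ1 JM].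
have noethR := local_noetherian hR.
have IJ a : I a -> adjoin (M := R^o) I x a by apply: adjoin_sub.
split=> // [/IJ //|a0 b0 I0]; apply: contrapT => /not_orP[na0 nb0].
have zdJ a b : I (a * b) -> ~ I a -> adjoin (M := R^o) I x b.
  move=> Iab nIa; apply: contrapT => nJb; apply: nIa.
  apply: (nakayama (local_prime hR) (M := R^o) (L := I) (Z := fun c => I (c * b))) => //.
    exact: (submodule_saturated hR).
  move=> c Icb; apply: (saturation_sub (local_prime hR)).
  have [[r [i [Ii cE]]]|//] := JM c b (IJ _ Icb).
  have Irb : I (r * b).
    apply: xreg; have -> : x * (r * b) = c * b - i * b.
      by rewrite cE mulrDl addrK mulrA (mulrC x).
    by apply: (submoduleB iI) => //; apply: ideal_mulr.
  rewrite cE; apply: (submoduleD (span_submodule _)); apply: span_in; last by left.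
  by right; exists x, r; split=> //; exact: (mulrC r x).
have [||_ [[a [b [nIa nIb Iab ->]]] _ maxa]] := exists_maximal_submodule (M := R^o)
  (Phi := fun K => exists a b, [/\ ~ I a, ~ I b, I (a * b) & K = adjoin (M := R^o) I a])
  (S0 := adjoin (M := R^o) I a0) noethR.
- by move=> _ [a [b [_ _ _ ->]]]; apply: adjoin_submodule.
- by exists a0, b0.
have [|r [i [Ii aE]]] := zdJ b a _ nIb; first by rewrite mulrC.
have nIr : ~ I r.
  by move=> Ir; apply: nIa; rewrite aE; apply: (submoduleD iI) => //; apply: ideal_mulr.
have Irb : I (r * b).
  apply: xreg.
  have -> : x * (r * b) = a * b - i * b.
    by rewrite aE mulrDl addrK mulrA (mulrC x).
  by apply: (submoduleB iI) => //; apply: ideal_mulr.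
have [|y [r' [i' [Ii' yE]]]|s [i' [Ii' rE]]] :=
  maxa (adjoin (M := R^o) I r) _ _ r (adjoin_gen _ iI).
- by exists r, b.
- exists (r' * x), (r' * i + i'); split.
    by apply: (submoduleD iI) => //; apply: ideal_mull.
  rewrite yE aE; change (r' * (r * x + i) + i' = r' * x * r + (r' * i + i')).
  by rewrite mulrDr addrA -mulrA (mulrC r).
have rE' : r = s * (r * x + i) + i' by rewrite {1}rE {1}aE.
have Ir : I ((1 - s * x) * r).
  have -> : (1 - s * x) * r = s * i + i'; last first.
    by apply: (submoduleD iI) => //; apply: ideal_mull.
  rewrite mulrBl mul1r {1}rE' mulrDr (mulrC r) mulrA.
  by rewrite -!addrA addrC -!addrA addNr addr0.
have [|u Hu] := local_unit_1B hR (a := s * x).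
  exact: (ideal_mull _ (local_ideal hR)).
by apply: nIr; rewrite -[r]mul1r -Hu mulrAC mulrC; apply: ideal_mull.
Qed.

End PrimeQuotient.

Lemma downward_ind (P : nat -> Prop) n :
  P n -> (forall k, (k < n)%N -> P k.+1 -> P k) -> forall k, (k <= n)%N -> P k.
Proof.
move=> Pn step; suff H d k : (k + d)%N = n -> P k by move=> k /subnKC; apply: H.
elim: d k => [|d IH] k; rewrite ?addn0 ?addnS => E; first by rewrite E.
apply: step; first by rewrite -E ltnS leq_addr.
by apply: IH; rewrite addSn.
Qed.

Lemma row_mul_delta (R : comNzRingType) n p (u : 'rV[R]_n) (i : 'I_n) (j : 'I_p) :
  u *m delta_mx i j = u 0 i *: delta_mx 0 j.
Proof.
apply/rowP => l; rewrite !mxE (bigD1 i) //= big1 => [|k /negPf ki].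
  by rewrite !mxE !eqxx addr0.
by rewrite mxE ki mulr0.
Qed.

Section Koszul.
Variables (R : comNzRingType) (m : {pred R}) (hR : local_ring m).
Variables (e : nat) (x : 'cV[R]_e).
Hypothesis gen_m : forall a, a \in m <-> exists v : 'rV_e, a = (v *m x) 0 0.

Definition syzygy (v : 'rV[R]_e) := v *m x = 0.

Hypothesis min_gen : forall v, syzygy v -> forall j, v 0 j \in m.

Definition trivial_syzygy (v : 'rV[R]_e) : Prop :=
  exists i j, v = x i 0 *: delta_mx 0 j - x j 0 *: delta_mx 0 i.

Definition alternating (M : 'M[R]_e) :=
  (forall i j, M i j = - M j i) /\ forall i, M i i = 0.

(** The preimage of zero in [H_1(K) (x) k], [K] being the Koszul complex. *)
Definition trivial_mod_m : 'rV[R]_e -> Prop := span (fun w =>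
  trivial_syzygy w \/ exists a z, [/\ a \in m, syzygy z & w = a *: z]).

Let vanishes k (v : 'rV[R]_e) := forall j : 'I_e, (k <= j)%N -> v 0 j = 0.
Let koszul k (v : 'rV[R]_e) := exists M, [/\ alternating M,
  forall i j : 'I_e, (k <= j)%N -> M i j = 0 & v = x^T *m M].

Lemma x_in_m i : x i 0 \in m.
Proof. by apply/gen_m; exists (delta_mx 0 i); rewrite -rowE mxE. Qed.

Lemma koszul_submodule k : submodule (koszul k).
Proof.
split=> [|a _ _ [M [[altM dM] sM ->]] [N [[altN dN] sN ->]]].
  exists 0; rewrite mulmx0; split=> // [|i j _]; last by rewrite mxE.
  by split=> i *; rewrite !mxE ?oppr0.
exists (a *: M + N); split; last by rewrite mulmxDr scalemxAr.
  split=> [i j|i]; rewrite !mxE; last by rewrite dM dN mulr0 addr0.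
  by rewrite altM altN mulrN opprD.
by move=> i j kj; rewrite !mxE sM // sN // mulr0 addr0.
Qed.

Lemma trivial_syzygy_koszul v : span trivial_syzygy v -> koszul e v.
Proof.
move/(_ _ (koszul_submodule e)); apply=> _ [i [j ->]].
exists (delta_mx i j - delta_mx j i); split.
- split=> [k l|k]; rewrite !mxE ?opprB; last by rewrite andbC subrr.
  by rewrite ![(_ == i) && _]andbC [(_ == j) && _]andbC.
- by move=> k l; rewrite leqNgt ltn_ord.
- by rewrite mulmxBr !row_mul_delta !mxE.
Qed.

(** Rigidity of the Koszul complex: when a syzygy of the first [k] elements is
    written as a trivial syzygy of [k + 1] elements, the coefficients at the
    last element form a syzygy [a] of the first [k] ones, so that the given
    syzygy is trivial up to a multiple of [a]; Nakayama's lemma concludes. *)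
Lemma koszul_rigid k : (k < e)%N ->
  (forall v, vanishes k.+1 v -> syzygy v -> koszul k.+1 v) ->
  forall v, vanishes k v -> syzygy v -> koszul k v.
Proof.
move=> ltke kosS v0 van0 syz0; pose K := Ordinal ltke.
apply: (nakayama (local_prime hR) (L := koszul k)
  (Z := fun v => vanishes k v /\ syzygy v)) => //.
- exact: (rV_noetherian hR).
- exact: koszul_submodule.
- exact: (submodule_saturated hR (koszul_submodule k)).
move=> v [van syz] {v0 van0 syz0}; apply: (saturation_sub (local_prime hR)).
have [|M [[altM dM] sM vE]] := kosS v _ syz; first by move=> j /ltnW/van.
pose a := \row_i M i K.
pose M' := \matrix_(i, j) if (i == K) || (j == K) then 0 else M i j.
have -> : v = x^T *m M' + (- x K 0) *: a.
  apply/rowP => l; rewrite !mxE; have [->|nlK] := eqVneq l K.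
    rewrite van // dM mulr0 addr0 big1 // => i _.
    by rewrite [M' i K]mxE eqxx orbT mulr0.
  rewrite vE mxE (bigD1 K) //= [in RHS](bigD1 K) //= [M' K l]mxE eqxx mulr0 add0r.
  rewrite [in LHS]addrC [M K l]altM mxE mulrN mulNr; congr (_ - _).
  by apply: eq_bigr => i niK; rewrite mxE [M' i l]mxE (negPf niK) (negPf nlK).
apply: (submoduleD (span_submodule _)); apply: span_in.
  left; exists M'; split=> //.
    split=> [i j|i]; rewrite !mxE; last by rewrite dM if_same.
    by rewrite orbC; case: ifP => _; rewrite ?oppr0.
  move=> i j; rewrite leq_eqVlt mxE => /predU1P[kj|/sM->]; last by rewrite if_same.
  by rewrite (_ : j = K) ?eqxx ?orbT //; apply: val_inj.
right; exists (- x K 0), a; split=> //.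
  by apply: (submoduleN (local_ideal hR)); apply: x_in_m.
split=> [j|].
  rewrite leq_eqVlt mxE => /predU1P[kj|kj]; last by rewrite altM sM ?oppr0.
  by rewrite (_ : j = K) //; apply: val_inj.
apply/rowP => j; rewrite ord1 !mxE -[RHS](van K) // vE mxE.
by apply: eq_bigr => i _; rewrite !mxE mulrC.
Qed.

Hypothesis syzygies_trivial : forall v, syzygy v -> trivial_mod_m v.

Lemma all_koszul k : (k <= e)%N -> forall v, vanishes k v -> syzygy v -> koszul k v.
Proof.
move: k; apply: downward_ind => [v _ syz|k]; last exact: koszul_rigid.
  apply: trivial_syzygy_koszul.
  apply: (nakayama (local_prime hR) (Z := syzygy)) syz.
  - exact: (rV_noetherian hR).
  - exact: span_submodule.
  - exact: (submodule_saturated hR (span_submodule _)).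
  move=> z syz; apply: (saturation_sub (local_prime hR)) => S hS subS.
  apply: (syzygies_trivial syz) => // w [tw|nw]; apply: subS; last by right.
  by left; apply: span_in.
Qed.

Definition initial_ideal k (a : R) := exists v, vanishes k v /\ a = (v *m x) 0 0.

Lemma initial_ideal_ideal k : ideal (initial_ideal k).
Proof.
apply: idealP => [|a _ _ [v [vanv ->]] [w [vanw ->]]].
  by exists 0; split=> [j _|]; rewrite ?mul0mx mxE.
exists (a *: v + w); split=> [j kj|]; first by rewrite !mxE vanv // vanw // mulr0 addr0.
by rewrite mulmxDl -scalemxAl !mxE.
Qed.

(** The last coefficient of a trivial syzygy of the first [k + 1] generators lies
    in the ideal of the first [k] ones. *)
Lemma initial_ideal_regular (k : 'I_e) b :
  initial_ideal k (x k 0 * b) -> initial_ideal k b.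
Proof.
move=> [v [vanv xbE]].
have [||M [[altM dM] sM vE]] := @all_koszul k.+1 (ltn_ord k) (v - b *: delta_mx 0 k).
- move=> j kj; have /negPf jk : j != k by apply: contraTneq kj => ->; rewrite ltnn.
  by rewrite !mxE vanv ?(ltnW kj) // jk mulr0 subr0.
- apply/rowP => j; rewrite ord1 /syzygy mulmxBl -scalemxAl -rowE !mxE.
  by move: xbE; rewrite mxE mulrC => ->; rewrite subrr.
exists (- \row_i M i k); split=> [j|].
  rewrite leq_eqVlt !mxE => /predU1P[kj|kj]; last by rewrite altM sM ?opprK.
  by rewrite (_ : j = k) ?dM ?oppr0 //; apply: val_inj.
have /rowP/(_ k) := vE; rewrite !mxE vanv // !eqxx mulr1 sub0r => /(congr1 -%R).
rewrite opprK => ->; rewrite -sumrN; apply: eq_bigr => i _.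
by rewrite !mxE mulNr mulrC.
Qed.

Lemma initial_ideal_full a : initial_ideal e a <-> a \in m.
Proof.
split=> [[v [_ aE]]|/gen_m[v aE]]; first by apply/gen_m; exists v.
by exists v; split=> // j; rewrite leqNgt ltn_ord.
Qed.

Lemma initial_idealS (k : 'I_e) :
  initial_ideal k.+1 = adjoin (M := R^o) (initial_ideal k) (x k 0).
Proof.
apply/funext => a; apply/propext; split=> [[v [vanv ->]]|[r [_ [[v [vanv ->]] ->]]]].
  exists (v 0 k), (((v - v 0 k *: delta_mx 0 k) *m x) 0 0); split.
    exists (v - v 0 k *: delta_mx 0 k); split=> // j; rewrite leq_eqVlt !mxE.
    move=> /predU1P[kj|kj].
      by rewrite (_ : j = k) ?eqxx ?mulr1 ?subrr //; apply: val_inj.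
    have /negPf-> : j != k by apply: contraTneq kj => ->; rewrite ltnn.
    by rewrite (vanv j kj) mulr0 subr0.
  rewrite mulmxBl -scalemxAl -rowE; move: (v *m x) => u; rewrite !mxE.
  by change (u 0 0 = v 0 k * x k 0 + (u 0 0 - v 0 k * x k 0)); rewrite addrC subrK.
exists (r *: delta_mx 0 k + v); split=> [j kj|].
  have /negPf jk : j != k by apply: contraTneq kj => ->; rewrite ltnn.
  by rewrite !mxE vanv ?(ltnW kj) // jk mulr0 addr0.
by rewrite mulmxDl -scalemxAl -rowE; move: (v *m x) => u; rewrite !mxE.
Qed.

Lemma initial_ideal_prime k : (k <= e)%N -> prime_ideal (initial_ideal k).
Proof.
move: k; apply: downward_ind => [|k ltk prSk].
  rewrite (_ : initial_ideal e = fun a => a \in m); first exact: local_prime.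
  by apply/funext => a; apply/propext; apply: initial_ideal_full.
apply: (prime_ideal_of_adjoin hR (x := x (Ordinal ltk) 0)).
- exact: initial_ideal_ideal.
- exact: x_in_m.
- exact: (@initial_ideal_regular (Ordinal ltk)).
- by rewrite -(@initial_idealS (Ordinal ltk)).
Qed.

Lemma initial_ideal_strict (k l : 'I_e.+1) : (k < l)%N ->
  strictly_below (initial_ideal k) (initial_ideal l).
Proof.
move=> ltkl; split=> [a [v [vanv ->]]|].
  by exists v; split=> // j lj; apply: vanv; apply: leq_trans lj; apply: ltnW.
have ltke : (k < e)%N by apply: leq_trans ltkl _; rewrite -ltnS ltn_ord.
pose K := Ordinal ltke; exists (x K 0); split.
  exists (delta_mx 0 K); split=> [j lj|]; last by rewrite -rowE mxE.
  have /negPf jK : j != K by apply: contraTneq lj => ->; rewrite -ltnNge.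
  by rewrite !mxE jK.
move=> [v [vanv xE]]; have := local_not1 hR; apply/negP/negPn.
have syz : syzygy (delta_mx 0 K - v).
  by apply/rowP => j; rewrite ord1 mulmxBl -rowE !mxE xE !mxE subrr.
by have := min_gen syz K; rewrite !mxE !eqxx vanv // subr0.
Qed.

(** The generators form a regular sequence, hence their initial segments generate
    a chain of primes, which has maximal length by the height theorem. *)
Lemma regular_of_trivial_syzygies : regular_local_ring m.
Proof.
split=> //; pose s := [seq x i 0 | i <- enum 'I_e].
have sz : size s = e by rewrite size_map size_enum_ord.
have s_m a : a \in s -> a \in m by case/mapP => i _ ->; apply: x_in_m.
have gen_s a : a \in m <-> span (M := R^o) (fun b => b \in s) a.
  split=> [/gen_m[v ->]|]; last first.
    by move/(_ _ (local_ideal hR)); apply => b; apply: s_m.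
  rewrite mxE; apply: (submodule_sum (span_submodule _)) => i _.
  apply: (ideal_mull _ (span_submodule _)); apply: span_in.
  by apply/mapP; exists i; rewrite ?mem_enum.
exists s; split=> [a|]; first by rewrite gen_s; apply: span_seqP.
rewrite sz; split.
  have pr (k : 'I_e.+1) : exists q : prime_idealr R, forall a, a \in q <-> initial_ideal k a.
    have [[q0 qD] q1 qM] := @initial_ideal_prime k (ltn_ord k).
    pose S : {pred R} := fun a => `[<initial_ideal k a>].
    have Sideal : idealr_closed S.
      split=> [||a u v /asboolP qu /asboolP qv]; try apply/asboolP=> //.
      exact: qD.
    have Sprime : prime_idealr_closed S.
      by move=> u v /asboolP/qM[qu|qv]; apply/orP; [left | right]; apply/asboolP.
    exists (HB.pack_for (prime_idealr R) (S : R -> bool) (isIdealr.Build R S Sideal)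
      (isPrimeIdealrClosed.Build R S Sprime)) => a.
    by split=> [/asboolP|/asboolP].
  exists (fun k => sval (cid (pr k))) => k l ltkl.
  case: cid => q /= hq; case: cid => q' /= hq'.
  have [le [a [la nka]]] := initial_ideal_strict ltkl.
  split=> [b /hq/le/hq' //|/(_ a)]; rewrite hq' => /(_ la)/hq //.
move=> n p chain_p; pose q k : R -> Prop := fun a => a \in p (inord k).
have prq k : prime_ideal (q k).
  split.
  - split=> [|a u v]; first exact: rpred0.
    by move=> qu qv; apply: rpredD => //; exact: idealMr qu.
  - by rewrite /q idealr1.
  - by move=> a b; rewrite /q prime_idealrM => /orP.
have qs : prime_chain_from (q 0) [seq q i | i <- iota 1 n].
  suff H l k : (k + l <= n)%N -> prime_chain_from (q k) [seq q i | i <- iota k.+1 l].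
    exact: H.
  elim: l k => [|l IH] k //= lekl; split=> //; last by apply: IH; rewrite addSnnS.
  have [|sub nsub] := chain_p (inord k) (inord k.+1).
    have ltkn : (k < n)%N by apply: leq_trans lekl; rewrite addnS ltnS leq_addr.
    by rewrite !inordK // ltnS ltnW.
  split; first exact: sub.
  by have /existsNP[a /not_implyP[qa nqa]] := nsub; exists a.
have := prime_chain_size (local_noetherian hR) (local_prime hR) (prime_le_local hR)
  (xs := s) (I := fun=> False) s_m _ _ (prq 0) qs.
rewrite size_map size_iota sz; apply=> // a /gen_s ga S hS subS.
by apply: ga => // b bs; apply: subS; right.
Qed.

End Koszul.

(** * Minimal free resolutions and lifting *)

Definition in_ideal (R : comNzRingType) (m : {pred R}) p q (A : 'M[R]_(p, q)) :=
  forall i j, A i j \in m.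

Section IdealMatrices.
Variables (R : comNzRingType) (m : {pred R}) (hR : local_ring m).

Lemma in_ideal0 p q : in_ideal m (0 : 'M[R]_(p, q)).
Proof. by move=> i j; rewrite mxE; apply: (local_ideal hR).1. Qed.

Lemma in_idealD p q (A B : 'M[R]_(p, q)) :
  in_ideal m A -> in_ideal m B -> in_ideal m (A + B).
Proof. by move=> mA mB i j; rewrite mxE; apply: (submoduleD (local_ideal hR)). Qed.

Lemma in_idealN p q (A : 'M[R]_(p, q)) : in_ideal m A -> in_ideal m (- A).
Proof. by move=> mA i j; rewrite mxE; apply: (submoduleN (local_ideal hR)). Qed.

Lemma in_idealB p q (A B : 'M[R]_(p, q)) :
  in_ideal m A -> in_ideal m B -> in_ideal m (A - B).
Proof. by move=> mA mB; apply: in_idealD => //; apply: in_idealN. Qed.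

Lemma in_idealZ p q a (A : 'M[R]_(p, q)) : a \in m -> in_ideal m (a *: A).
Proof. by move=> ma i j; rewrite mxE; apply: (ideal_mulr _ (local_ideal hR)). Qed.

Lemma in_ideal_scale p q a (A : 'M[R]_(p, q)) : in_ideal m A -> in_ideal m (a *: A).
Proof. by move=> mA i j; rewrite mxE; apply: (ideal_mull _ (local_ideal hR)). Qed.

Lemma in_ideal_mull p q r (A : 'M[R]_(p, q)) (B : 'M[R]_(q, r)) :
  in_ideal m B -> in_ideal m (A *m B).
Proof.
move=> mB i j; rewrite mxE; apply: (submodule_sum (local_ideal hR)) => k _.
exact: (ideal_mull _ (local_ideal hR)).
Qed.

Lemma in_ideal_mulr p q r (A : 'M[R]_(p, q)) (B : 'M[R]_(q, r)) :
  in_ideal m A -> in_ideal m (A *m B).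
Proof.
move=> mA i j; rewrite mxE; apply: (submodule_sum (local_ideal hR)) => k _.
exact: (ideal_mulr _ (local_ideal hR)).
Qed.

Lemma in_ideal_sum p q (I : finType) (F : I -> 'M[R]_(p, q)) :
  (forall i, in_ideal m (F i)) -> in_ideal m (\sum_i F i).
Proof.
move=> mF; elim/big_ind: _ => //; [exact: in_ideal0 | exact: in_idealD].
Qed.

Definition minimal_rows k n (G : 'M[R]_(k, n)) :=
  forall w : 'rV_k, w *m G = 0 -> in_ideal m w.

Lemma mulmx_lift k n (w : 'rV[R]_k.+1) (G : 'M[R]_(k.+1, n)) j :
  w 0 j = 0 -> w *m G = col' j w *m row' j G.
Proof.
move=> wj; apply/rowP => l; rewrite !mxE (bigD1_ord j) //= wj mul0r add0r.
by apply: eq_bigr => i _; rewrite !mxE.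
Qed.

(** In a shortest system of generators no relation has an invertible coefficient,
    since the corresponding generator could be dropped. *)
Lemma minimal_generators n (S : 'rV[R]_n -> Prop) : submodule S ->
  exists k (G : 'M[R]_(k, n)), (forall v, S v <-> exists w, v = w *m G) /\ minimal_rows G.
Proof.
move=> hS; pose gens k := exists G : 'M[R]_(k, n), forall v, S v <-> exists w, v = w *m G.
have ex_gens : exists k, `[<gens k>].
  have [s hs] := rV_noetherian hR hS; exists (size s); apply/asboolP.
  exists (\matrix_(i < size s) s`_i) => v.
  rewrite hs span_seqP; split=> [[c ->]|[w ->]].
    exists (\row_i c i); rewrite mulmx_sum_row; apply: eq_bigr => i _.
    by rewrite mxE rowK.
  exists (w 0); rewrite mulmx_sum_row; apply: eq_bigr => i _.
  by rewrite rowK.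
case: (ex_minnP ex_gens) => k /asboolP[G genG] mink; exists k, G; split=> // w wG i j.
rewrite ord1 {i}; apply: contrapT => /negP/(local_unit hR)[u wju].
case: k G genG mink w wG j wju => [|k] G genG mink w wG j wju; first by have := ltn_ord j.
suff /asboolP/mink : gens k by rewrite ltnn.
exists (row' j G) => v; rewrite genG; split=> [[w' ->]|[w' ->]].
  exists (col' j (w' - (w' 0 j * u) *: w)); rewrite -mulmx_lift.
    by rewrite mulmxBl -scalemxAl wG scaler0 subr0.
  by rewrite !mxE -mulrA (mulrC u) wju mulr1 subrr.
exists (\row_i if unlift j i is Some i' then w' 0 i' else 0).
rewrite (mulmx_lift _ (j := j)); last by rewrite mxE unlift_none.
by congr (_ *m _); apply/rowP => i; rewrite !mxE liftK.
Qed.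

(** The rank of the free module in degree [n].  The shift makes the rank one in
    degree zero hold by computation. *)
Definition rank_of (b : nat -> nat) (n : nat) : nat := if n is n'.+1 then b n' else 1.

(** [d] is a minimal free resolution of the residue field, by the free modules
    of ranks [1, b 0, b 1, ...]; matrices act on row vectors from the right. *)
Record minimal_resolution (b : nat -> nat)
    (d : forall n, 'M[R]_(rank_of b n.+1, rank_of b n)) : Prop := MinimalResolution {
  minimal_diff : forall n, in_ideal m (d n);
  minimal_aug : forall r (A : 'M_(r, rank_of b 0)), in_ideal m A -> exists B, B *m d 0 = A;
  minimal_complex : forall n, d n.+1 *m d n = 0;
  minimal_exact : forall n r (A : 'M_(r, rank_of b n.+1)), A *m d n = 0 ->
    exists B, B *m d n.+1 = A
}.

Lemma lift_rows k l r (G : 'M[R]_(l, k)) (A : 'M[R]_(r, k)) :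
  (forall i, exists w, row i A = w *m G) -> exists B, B *m G = A.
Proof.
move=> hA; exists (\matrix_i sval (cid (hA i))); apply/row_matrixP => i.
by rewrite row_mul rowK; case: cid.
Qed.

Lemma minimal_kernel k l (G : 'M[R]_(l, k)) :
  {l' : nat & {G' : 'M[R]_(l', l) |
    (forall v : 'rV_l, v *m G = 0 <-> exists w : 'rV_l', v = w *m G') /\
    minimal_rows G'}}.
Proof.
have [|l' hl'] := cid (minimal_generators (S := fun v : 'rV_l => v *m G = 0) _).
  by split=> [|a x y xG yG]; rewrite ?mul0mx // mulmxDl -scalemxAl xG yG scaler0 addr0.
by exists l'; apply: cid hl'.
Qed.

Lemma exists_minimal_resolution : exists b d, @minimal_resolution b d.
Proof.
have [|l0 [G0 [genG0 minG0]]] := minimal_generators (S := fun v : 'rV_1 => v 0 0 \in m).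
  by have [m0 mD] := local_ideal hR; split=> [|a x y]; rewrite !mxE //; apply: mD.
pose st := nat_rect (fun=> {k & {l & 'M[R]_(l, k)}})
  (existT _ 1%N (existT _ l0 G0)) (fun _ t => existT _ (tag (tagged t))
     (existT _ (tag (minimal_kernel (tagged (tagged t))))
               (sval (tagged (minimal_kernel (tagged (tagged t))))))).
pose b n := tag (tagged (st n)).
pose d n : 'M[R]_(rank_of b n.+1, rank_of b n) :=
  match n return 'M[R]_(rank_of b n.+1, rank_of b n) with
  | 0 => tagged (tagged (st 0))
  | n'.+1 => tagged (tagged (st n'.+1))
  end.
(* Each differential is a system of generators of the kernel of the previous
   one, minimal by construction. *)
have dS n : (forall v : 'rV_(_), v *m d n = 0 <-> exists w : 'rV_(_), v = w *m d n.+1) /\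
    minimal_rows (d n.+1).
  case: n => [|n]; rewrite /d /=.
    exact: (svalP (tagged (minimal_kernel G0))).
  exact: (svalP (tagged (minimal_kernel (tagged (tagged (st n.+1)))))).
have dd n : d n.+1 *m d n = 0.
  apply/row_matrixP => i; rewrite row_mul row0; apply/(dS n).1.
  by exists (delta_mx 0 i); rewrite -rowE.
exists b, d; split=> //.
- case=> [|n] i j.
    have /genG0 : exists w, row i (d 0) = w *m G0.
      by exists (delta_mx 0 i); rewrite rowE.
    by rewrite mxE ord1.
  have : in_ideal m (row i (d n.+1)); last by move/(_ 0 j); rewrite mxE.
  case: n => [|n] in i j *; [apply: minG0 | apply: (dS n).2];
    by rewrite -row_mul (dd _) row0.
- move=> r A mA; apply: lift_rows => i; apply/genG0; rewrite mxE; apply: mA.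
- move=> n r A Ad; apply: lift_rows => i; apply/(dS n).1.
  by rewrite -row_mul Ad row0.
Qed.

Section Lifting.
Variables (b : nat -> nat) (d : forall n, 'M[R]_(rank_of b n.+1, rank_of b n)).
Hypothesis hd : minimal_resolution d.
Local Notation a := (rank_of b).

(** A family of matrices with values in [R ^ c], indexed by [J], is a linear
    map to [R ^ c] from the direct sum of the [R ^ (r j)].  An endomorphism of
    square zero of that sum, with coefficients in [m], acts on the families by
    composition; such an action is all that the lifting arguments need.  *)
Variables (J : Type) (r : J -> nat).
Definition family (c : nat) := forall j : J, 'M[R]_(r j, c).
Variable Delta : forall c, family c -> family c.
Hypothesis DeltaM : forall c c' (X : family c) (D : 'M_(c, c')) j,
  Delta (fun j => X j *m D) j = Delta X j *m D.
Hypothesis DeltaB : forall c (X Y : family c) j,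
  Delta (fun j => X j - Y j) j = Delta X j - Delta Y j.
Hypothesis DeltaK : forall c (X : family c) j, Delta (Delta X) j = 0.
Hypothesis Delta_in : forall c (X : family c) j, in_ideal m (Delta X j).

(** The comparison theorem.  The value in degree zero can be arbitrary because
    [Delta] is zero modulo [m], that is, on the residue field.  A lift is chosen
    equal to [C] where [C] is a lift; this is used to keep the lifts homogeneous
    and to prescribe some of them. *)
Lemma lift_family (X0 : family (a 0)) (C : forall n, family (a n)) :
  exists X : forall n, family (a n), X 0 = X0 /\ forall n j,
    X n.+1 j *m d n = Delta (X n) j /\
    (C n.+1 j *m d n = Delta (X n) j -> X n.+1 j = C n.+1 j).
Proof.
have [//|n X hX|X [X00 hX]] := dependent_choice (T := fun n => family (a n))
  (P := fun n X => forall j, exists A, A *m d n = Delta X j)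
  (Q := fun n X X' => forall j, X' j *m d n = Delta X j /\
    (C n.+1 j *m d n = Delta X j -> X' j = C n.+1 j)) (t0 := X0).
- by move=> j; apply: (minimal_aug hd).
- have hX' j : exists A, A *m d n = Delta X j /\
      (C n.+1 j *m d n = Delta X j -> A = C n.+1 j).
    have [CE|nCE] := pselect (C n.+1 j *m d n = Delta X j); first by exists (C n.+1 j).
    by have [A AE] := hX j; exists A.
  exists (fun j => sval (cid (hX' j))); split=> j; last exact: (svalP (cid (hX' j))).
  apply: (minimal_exact hd); rewrite -DeltaM -[RHS](DeltaK X j); congr (Delta _ j).
  by apply/functional_extensionality_dep => i; case: (svalP (cid (hX' i))).
by exists X; split=> // n; apply: (hX n).2.
Qed.

(** Uniqueness of lifts up to homotopy, for the difference of two lifts. *)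
Lemma homotopy_family (E : forall n, family (a n)) :
    (forall n j, E n.+1 j *m d n = Delta (E n) j) ->
    (forall j, in_ideal m (E 0 j)) ->
  exists H : forall n, family (a n), forall n j,
    E n j = H n.+1 j *m d n + Delta (H n) j.
Proof.
move=> hE mE.
have [|n H hH|H [_ hH]] := dependent_choice (T := fun n => family (a n))
  (P := fun n H => forall j, exists A, A *m d n = E n j - Delta H j)
  (Q := fun n H H' => forall j, H' j *m d n = E n j - Delta H j)
  (t0 := fun=> 0).
- by move=> j; apply: (minimal_aug hd); apply: in_idealB.
- exists (fun j => sval (cid (hH j))); split=> j; last exact: (svalP (cid (hH j))).
  apply: (minimal_exact hd); rewrite mulmxBl hE -DeltaM.
  have -> : (fun j => sval (cid (hH j)) *m d n) = (fun j => E n j - Delta H j).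
    by apply/functional_extensionality_dep => i; apply: (svalP (cid (hH i))).
  by rewrite DeltaB DeltaK subr0 subrr.
by exists H => n j; rewrite (hH n).2 subrK.
Qed.

(** Homotopic maps agree modulo [m], since all the differentials are zero there. *)
Lemma family_in_ideal (E : forall n, family (a n)) :
    (forall n j, E n.+1 j *m d n = Delta (E n) j) ->
    (forall j, in_ideal m (E 0 j)) -> forall n j, in_ideal m (E n j).
Proof.
move=> hE /(homotopy_family hE)[H EH] n j; rewrite EH; apply: in_idealD => //.
by apply: in_ideal_mull; apply: (minimal_diff hd).
Qed.

End Lifting.
End IdealMatrices.

(** * A degree -2 operator that is surjective modulo the maximal ideal *)

Lemma sum_alternating (V : zmodType) n (T : 'I_n -> 'I_n -> V) :
  (forall j l, j != l -> T j l = - T l j) ->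
  \sum_j \sum_l T j l = \sum_j T j j.
Proof.
move=> altT.
have split3 j : \sum_l T j l =
    T j j + (\sum_(l : 'I_n | (l < j)%N) T j l + \sum_(l : 'I_n | (j < l)%N) T j l).
  rewrite (bigD1 j) //= (bigID (fun l : 'I_n => (l < j)%N)) /=; congr (_ + (_ + _)).
    by apply: eq_bigl => l; rewrite neq_ltn; case: ltngtP.
  by apply: eq_bigl => l; rewrite neq_ltn; case: ltngtP.
rewrite (eq_bigr _ (fun j _ => split3 j)) !big_split /=.
rewrite [X in _ + (X + _)](exchange_big_dep predT) //=.
rewrite -big_split /= [X in _ + X]big1 ?addr0 // => j _; rewrite -big_split /=.
rewrite big1 // => l ltjl; rewrite altT ?addNr //.
by rewrite neq_ltn ltjl orbT.
Qed.

(** Linear algebra over the residue field of [R]: a submodule above [W] that is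
    maximal among those that avoid [u] is a hyperplane modulo [m]. *)
Lemma separating_functional (R : comNzRingType) (m : {pred R}) (hR : local_ring m) n
    (W : 'rV[R]_n -> Prop) (u : 'rV[R]_n) :
    submodule W -> (forall a v, a \in m -> W (a *: v)) -> ~ W u ->
  exists f : 'cV[R]_n,
    (forall w, W w -> in_ideal m (w *m f)) /\ in_ideal m (u *m f - 1%:M).
Proof.
move=> hW mW nWu.
have [||W' [[hW' nW'u] WW' maxW']] := exists_maximal_submodule
  (Phi := fun S => submodule S /\ ~ S u) (S0 := W) (@rV_noetherian _ _ hR n).
- by move=> S [].
- by split.
have mW' a v : a \in m -> W' (a *: v) by move=> ma; apply/WW'/mW.
have notm a : W' (a *: u) -> a \in m.
  move=> W'au; apply: contrapT => /negP/(local_unit hR)[a' aa']; apply: nW'u.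
  by rewrite -[u]scale1r -aa' mulrC -scalerA; apply: submoduleZ.
have coef v : exists a, W' (v - a *: u).
  have [W'v|nW'v] := pselect (W' v); first by exists 0; rewrite scale0r subr0.
  have [r [w [W'w uE]]] : adjoin W' v u.
    apply: contrapT => nu; apply: nW'v.
    apply: (maxW' (adjoin W' v)); last exact: adjoin_gen.
      by split=> //; apply: adjoin_submodule.
    by move=> w; apply: adjoin_sub.
  have nmr : r \notin m.
    by apply/negP => mr; apply: nW'u; rewrite uE; apply: (submoduleD hW') => //; apply: mW'.
  have [r' rr'] := local_unit hR nmr; exists r'.
  rewrite uE scalerDr scalerA mulrC rr' scale1r opprD addNKr.
  by apply: (submoduleN hW'); apply: submoduleZ.
pose f : 'cV[R]_n := \col_i sval (cid (coef (delta_mx 0 i))).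
have fP v : W' (v - (v *m f) 0 0 *: u).
  rewrite {1}[v]row_sum_delta mxE scaler_suml -sumrB.
  apply: (submodule_sum hW') => i _; rewrite -scalerA -scalerBr.
  by apply: (submoduleZ hW'); rewrite mxE; case: cid.
exists f; split=> [w Ww|] i j; rewrite !ord1.
  by apply: notm; rewrite -[_ *: u](subKr w); apply: (submoduleB hW') => //; apply: WW'.
rewrite !mxE eqxx -opprB; apply: (submoduleN (local_ideal hR)); apply: notm.
by rewrite scalerBl scale1r; have := fP u; rewrite mxE.
Qed.

Section TateOperators.
Variables (R : comNzRingType) (m : {pred R}) (hR : local_ring m).
Variables (b : nat -> nat) (d : forall n, 'M[R]_(rank_of b n.+1, rank_of b n)).
Hypothesis hd : minimal_resolution m d.
Local Notation a := (rank_of b).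

Definition after_diff c (Y : forall p, 'M[R]_(a p, c)) p : 'M[R]_(a p, c) :=
  match p with 0 => 0 | p'.+1 => d p' *m Y p' end.

Lemma after_diffM c c' (Y : forall p, 'M[R]_(a p, c)) (D : 'M_(c, c')) p :
  after_diff (fun p => Y p *m D) p = after_diff Y p *m D.
Proof. by case: p => [|p] /=; rewrite ?mul0mx ?mulmxA. Qed.

Lemma after_diffB c (X Y : forall p, 'M[R]_(a p, c)) p :
  after_diff (fun p => X p - Y p) p = after_diff X p - after_diff Y p.
Proof. by case: p => [|p] /=; rewrite ?subr0 ?mulmxBr. Qed.

Lemma after_diffK c (Y : forall p, 'M[R]_(a p, c)) p :
  after_diff (after_diff Y) p = 0.
Proof.
by case: p => [|[|p]] //=; rewrite ?mulmx0 // mulmxA (minimal_complex hd) mul0mx.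
Qed.

Lemma after_diff_in c (Y : forall p, 'M[R]_(a p, c)) p :
  in_ideal m (after_diff Y p).
Proof.
case: p => [|p] /=; first exact: (in_ideal0 hR).
by apply: (in_ideal_mulr hR); apply: (minimal_diff hd).
Qed.

(** Every functional on the free module in degree 2 is a cocycle modulo [m],
    hence extends to an endomorphism of the resolution of degree -2. *)
Lemma exists_degree2_operator (f : 'M[R]_(a 2, a 0)) :
  exists theta : forall n, 'M[R]_(a n.+2, a n),
    theta 0 = f /\ forall n, theta n.+1 *m d n = d n.+2 *m theta n.
Proof.
have [X [X0 hX]] := lift_family hd (r := a) (Delta := after_diff)
  after_diffM after_diffK after_diff_in
  (fun p => match p return 'M_(a p, a 0) with 2 => f | _ => 0 end) (fun n p => 0).
by exists (fun n => X n n.+2); rewrite X0; split=> // n; rewrite (hX n n.+3).1.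
Qed.

Local Notation e := (b 0).
Local Notation x := (d 0).
Variable c : 'rV[R]_e.
Hypothesis syz_c : syzygy x c.

Lemma syzygy_in : in_ideal m c.
Proof.
have [B <-] := minimal_exact hd (n := 0) syz_c.
by apply: (in_ideal_mull hR); apply: (minimal_diff hd).
Qed.

Definition flip (j : 'I_e) (S : {set 'I_e}) := if j \in S then S :\ j else j |: S.
Definition sign_before (j : 'I_e) (S : {set 'I_e}) : R :=
  (-1) ^+ #|[set i in S | (i < j)%N]|.
Definition flip_coef (j : 'I_e) (S : {set 'I_e}) : R :=
  sign_before j S * (if j \in S then x j 0 else c 0 j).

(** The differential of [K<Y | dY = sum_j c_j X_j> (x) A], where [K] is the Koszul
    complex of [x] and [A] the resolution, acting on linear maps to [R ^ k].  The
    pair [(S, p)] stands for the summand [X_S Y^(i) (x) A_p], where the exponent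
    [i] is determined by the total degree: flipping an element of [S] removes it,
    with coefficient [x j 0], or trades a [Y] for it, with coefficient [c 0 j].
    Negative exponents are excluded by the vanishing of the maps in question. *)
Definition tate_action k (X : family R (fun Sp : {set 'I_e} * nat => a Sp.2) k) :
    family R (fun Sp : {set 'I_e} * nat => a Sp.2) k := fun Sp =>
  (-1) ^+ #|Sp.1| *: after_diff (fun p => X (Sp.1, p)) Sp.2
  + \sum_j flip_coef j Sp.1 *: (X (flip j Sp.1, Sp.2) : 'M_(a Sp.2, k)).

Lemma in_flip i j S : (i \in flip j S) = (i \in S) (+) (i == j).
Proof.
rewrite /flip; case: ifPn => jS; rewrite !inE; case: eqP => [->|] //=.
- by rewrite jS.
- by rewrite addbF.
- by rewrite addbT (negPf jS).
- by rewrite addbF.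
Qed.

Lemma flipC j l S : flip l (flip j S) = flip j (flip l S).
Proof. by apply/setP => i; rewrite !in_flip addbAC. Qed.

Lemma flipK j S : flip j (flip j S) = S.
Proof. by apply/setP => i; rewrite !in_flip addbK. Qed.

Lemma card_flip j S : #|flip j S| = if j \in S then #|S|.-1 else #|S|.+1.
Proof.
rewrite /flip; case: ifPn => jS; last by rewrite cardsU1 jS.
by rewrite [in RHS](cardsD1 j) jS.
Qed.

Lemma sign_flip j S : (-1) ^+ #|flip j S| = - (-1) ^+ #|S| :> R.
Proof.
rewrite card_flip; case: ifPn => jS; last by rewrite exprS mulN1r.
by rewrite [in RHS](cardsD1 j) jS [#|S|](cardsD1 j) jS exprS mulN1r opprK.
Qed.

Lemma sign_before_flip_le (j l : 'I_e) S : (j <= l)%N ->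
  sign_before j (flip l S) = sign_before j S.
Proof.
move=> lejl; congr (_ ^+ #|pred_of_set _|); apply/setP => i; rewrite !inE in_flip.
by case: eqP => [->|]; rewrite ?addbF // ltnNge lejl !andbF.
Qed.

Lemma sign_before_flip_lt (j l : 'I_e) S : (j < l)%N ->
  sign_before l (flip j S) = - sign_before l S.
Proof.
move=> ltjl; rewrite /sign_before.
have -> : [set i in flip j S | (i < l)%N] = flip j [set i in S | (i < l)%N].
  by apply/setP => i; rewrite !inE !in_flip !inE; case: eqP => [->|]; rewrite ?ltjl ?andbT ?addbF.
exact: sign_flip.
Qed.

Lemma flip_coef_le (j l : 'I_e) S : (j < l)%N ->
  flip_coef j (flip l S) = flip_coef j S.
Proof.
move=> ltjl; rewrite /flip_coef sign_before_flip_le ?(ltnW ltjl) // in_flip.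
by rewrite (_ : (j == l) = false) ?addbF //; apply: contraTF ltjl => /eqP->; rewrite ltnn.
Qed.

Lemma flip_coef_gt (j l : 'I_e) S : (j < l)%N ->
  flip_coef l (flip j S) = - flip_coef l S.
Proof.
move=> ltjl; rewrite /flip_coef sign_before_flip_lt // in_flip mulNr.
by rewrite (_ : (l == j) = false) ?addbF //; apply: contraTF ltjl => /eqP->; rewrite ltnn.
Qed.

Lemma flip_coefC j l S : j != l ->
  flip_coef j S * flip_coef l (flip j S) = - (flip_coef l S * flip_coef j (flip l S)).
Proof.
rewrite neq_ltn => /orP[] lt; rewrite (flip_coef_le _ lt) (flip_coef_gt _ lt) mulrN.
  by rewrite mulrC.
by rewrite opprK mulrC.
Qed.

Lemma flip_coefK j S : flip_coef j S * flip_coef j (flip j S) = c 0 j * x j 0.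
Proof.
rewrite /flip_coef sign_before_flip_le // in_flip eqxx addbT mulrACA -expr2 sqrr_sign mul1r.
by case: (j \in S); rewrite //= mulrC.
Qed.

Lemma flip_coef_in j S : flip_coef j S \in m.
Proof.
apply: (ideal_mull _ (local_ideal hR)); case: ifP => _; last exact: syzygy_in.
exact: (minimal_diff hd).
Qed.

Lemma after_diff_linear k s (Y : forall p, 'M[R]_(a p, k)) (I : finType) (t : I -> R)
    (Z : I -> forall p, 'M[R]_(a p, k)) p :
  after_diff (fun p => s *: Y p + \sum_i t i *: Z i p) p =
  s *: after_diff Y p + \sum_i t i *: after_diff (Z i) p.
Proof.
case: p => [|p] /=; last first.
  rewrite mulmxDr -scalemxAr mulmx_sumr; congr (_ + _).
  by apply: eq_bigr => i _; rewrite -scalemxAr.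
by rewrite scaler0 add0r big1 // => i _; rewrite scaler0.
Qed.

Lemma tate_actionM k k' (X : family R _ k) (D : 'M_(k, k')) Sp :
  tate_action (fun j => X j *m D) Sp = tate_action X Sp *m D.
Proof.
case: Sp => S p; rewrite /tate_action /= mulmxDl -scalemxAl -after_diffM mulmx_suml.
by congr (_ + _); apply: eq_bigr => j _; rewrite -scalemxAl.
Qed.

Lemma tate_actionB k (X Y : family R _ k) Sp :
  tate_action (fun j => X j - Y j) Sp = tate_action X Sp - tate_action Y Sp.
Proof.
case: Sp => S p; rewrite /tate_action /= after_diffB scalerBr opprD addrACA -sumrB.
by congr (_ + _); apply: eq_bigr => j _; rewrite scalerBr.
Qed.

Lemma tate_action_in k (X : family R _ k) Sp : in_ideal m (tate_action X Sp).
Proof.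
apply: (in_idealD hR); first exact/(in_ideal_scale hR)/after_diff_in.
by apply: (in_ideal_sum hR) => j; apply: (in_idealZ hR); apply: flip_coef_in.
Qed.

Lemma tate_actionK k (X : family R _ k) Sp : tate_action (tate_action X) Sp = 0.
Proof.
case: Sp => S p; rewrite /tate_action /= after_diff_linear after_diffK scaler0 add0r.
rewrite scaler_sumr -big_split /=.
pose T j l : 'M[R]_(a p, k) := (flip_coef j S * flip_coef l (flip j S)) *: X (flip l (flip j S), p).
transitivity (\sum_j \sum_l T j l).
  apply: eq_bigr => j _; rewrite sign_flip scalerDr !scalerA mulrN scaleNr.
  rewrite [_ * flip_coef j S]mulrC addNKr ?addrA ?subrr ?add0r.
  by rewrite scaler_sumr; apply: eq_bigr => l _; rewrite scalerA.
rewrite sum_alternating => [|j l njl]; last by rewrite /T flip_coefC // flipC scaleNr.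
rewrite (eq_bigr (fun j => (c 0 j * x j 0) *: X (S, p))) => [|j _]; last first.
  by rewrite /T flip_coefK flipK.
rewrite -scaler_suml; have /matrixP/(_ 0 0) := syz_c; rewrite !mxE => ->.
by rewrite scale0r.
Qed.

End TateOperators.

Section TateModule.
Variables (R : comNzRingType) (m : {pred R}) (hR : local_ring m).
Variables (b : nat -> nat) (d : forall n, 'M[R]_(rank_of b n.+1, rank_of b n)).
Hypothesis hd : minimal_resolution m d.
Local Notation a := (rank_of b).
Local Notation e := (b 0).
Local Notation x := (d 0).
Variable c : 'rV[R]_e.
Hypothesis syz_c : syzygy x c.

Local Notation tate_family := (family R (fun Sp : {set 'I_e} * nat => a Sp.2)).

(** The product by the unit of the Tate algebra, as prescribed for its lift. *)
Definition unit_family n : tate_family (a n) := fun Sp =>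
  if Sp.1 == finset.set0 then \matrix_(i, j) ((Sp.2 == n) && (i == j :> nat))%:R else 0.

Lemma unit_family_id n : unit_family n (finset.set0, n) = 1%:M.
Proof. by apply/matrixP => i j; rewrite /unit_family /= eqxx !mxE eqxx. Qed.

Lemma unit_family0 n S p : (S != finset.set0) || (p != n) -> unit_family n (S, p) = 0.
Proof.
rewrite /unit_family /=; case: eqP => //= _ /negPf npn.
by apply/matrixP => i j; rewrite !mxE npn.
Qed.

Definition off_degree n (S : {set 'I_e}) p :=
  (n < #|S| + p)%N || odd (n + (#|S| + p)).

Lemma off_degree_flip n S p j : off_degree n.+1 S p -> off_degree n (flip j S) p.
Proof.
rewrite /off_degree card_flip; case: ifPn => [jS|_]; last by lia.
have : (0 < #|S|)%N by apply/card_gt0P; exists j.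
by move: #|S| => s; case: s => // s _ /=; rewrite addSn; lia.
Qed.

Lemma off_degree_pred n S p : off_degree n.+1 S p.+1 -> off_degree n S p.
Proof. by rewrite /off_degree; lia. Qed.

Lemma off_degree_unit n S p : off_degree n S p -> unit_family n (S, p) = 0.
Proof.
move=> off; apply: unit_family0; case: eqP off => //= ->.
by rewrite /off_degree cards0 add0n; case: eqP => // ->; rewrite ltnn addnn odd_double.
Qed.

(** The operators [U n (S, p)] describe the product by the element
    [X_S Y^(i)] of the Tate algebra [K<Y | dY = sum_j c_j X_j>], [K] being the
    Koszul complex of [x], from degree [p] to degree [n = p + #|S| + 2 i] of
    the resolution. *)
Lemma exists_tate_operators : exists U : forall n, tate_family (a n),
  [/\ forall n Sp, U n.+1 Sp *m d n = tate_action d c (U n) Sp,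
      U 0 = unit_family 0,
      forall n S p, off_degree n S p -> U n (S, p) = 0
    & forall n, U n (finset.set0, n) = 1%:M].
Proof.
have [U [U0 hU]] := lift_family hd (tate_actionM d c) (tate_actionK hd syz_c)
  (@tate_action_in _ _ hR _ _ hd _ syz_c) (unit_family 0) unit_family.
have Uoff n S p : off_degree n S p -> U n (S, p) = 0.
  elim: n S p => [|n IH] S p off; first by rewrite U0 off_degree_unit.
  rewrite (hU n (S, p)).2 ?off_degree_unit // mul0mx /tate_action /=.
  rewrite big1 ?addr0 => [|j _]; last by rewrite IH ?scaler0 //; apply: off_degree_flip.
  case: p off => [|p] off /=; first by rewrite scaler0.
  by rewrite IH ?mulmx0 ?scaler0 //; apply: off_degree_pred.
exists U; split=> // [n Sp|n]; first by case: (hU n Sp).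
elim: n => [|n IH]; first by rewrite U0 unit_family_id.
rewrite (hU n (finset.set0, n.+1)).2 unit_family_id // mul1mx /tate_action /=.
rewrite IH mulmx1 cards0 scale1r big1 ?addr0 // => j _.
by rewrite Uoff ?scaler0 // /off_degree card_flip inE cards0 addSn ltnW.
Qed.

Section Operators.
Variable U : forall n, tate_family (a n).
Hypothesis U_lift : forall n Sp, U n.+1 Sp *m d n = tate_action d c (U n) Sp.
Hypothesis U_0 : U 0 = unit_family 0.
Hypothesis U_off : forall n S p, off_degree n S p -> U n (S, p) = 0.
Hypothesis U_id : forall n, U n (finset.set0, n) = 1%:M.

Local Notation boundaries := (trivial_mod_m m x).

(** The product [X_j 1], which agrees with the [j]-th basis vector of the resolution
    up to a syzygy. *)
Definition generator_lift (j : 'I_e) : 'rV[R]_e := U 1 ([set j]%SET, 0).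

Lemma generator_lift_syzygy j : syzygy x (generator_lift j - delta_mx 0 j).
Proof.
rewrite /syzygy mulmxBl -rowE; apply/eqP; rewrite subr_eq0; apply/eqP.
have -> : generator_lift j *m x = U 1 ([set j]%SET, 0) *m d 0 by [].
rewrite U_lift /tate_action /= scaler0 add0r (bigD1 j) //= big1 => [|l nlj].
  rewrite addr0 U_0 /flip /flip_coef inE eqxx finset.setDv unit_family_id.
  rewrite /sign_before (_ : [set i in [set j]%SET | (i < j)%N]%SET = finset.set0).
    by rewrite cards0 mul1r; apply/matrixP => i k; rewrite !ord1 !mxE eqxx mulr1.
  by apply/setP => i; rewrite !inE; case: eqP => // ->; rewrite ltnn.
rewrite U_0 unit_family0 ?scaler0 // orbF; apply/set0Pn; exists l.
by rewrite in_flip inE eqxx addbT (negPf nlj).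
Qed.

Lemma koszul_generator_lift j l :
  boundaries (x j 0 *: generator_lift l - x l 0 *: generator_lift j).
Proof.
pose z i := generator_lift i - delta_mx 0 i.
have -> : x j 0 *: generator_lift l - x l 0 *: generator_lift j =
    (x j 0 *: delta_mx 0 l - x l 0 *: delta_mx 0 j) + (x j 0 *: z l - x l 0 *: z j).
  rewrite addrACA -opprD -!scalerDr /z; congr (_ *: _ - _ *: _).
    by rewrite addrC subrK.
  by rewrite addrC subrK.
have xm i : x i 0 \in m by apply: (minimal_diff hd).
have hz i k : boundaries (x k 0 *: z i).
  by apply: span_in; right; exists (x k 0), (z i); split=> //; apply: generator_lift_syzygy.
apply: (submoduleD (span_submodule _)); first by apply: span_in; left; exists j, l.
by apply: (submoduleB (span_submodule _)); apply: hz.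
Qed.

Lemma sign_before_notin (j : 'I_e) (S : {set 'I_e}) : (forall i, i \in S -> (j <= i)%N) ->
  sign_before R j S = 1.
Proof.
move=> hS; rewrite /sign_before (_ : [set i in S | (i < j)%N]%SET = finset.set0).
  by rewrite cards0.
by apply/setP => i; rewrite !inE; case: (boolP (i \in S)) => //= /hS; rewrite ltnNge => ->.
Qed.

Lemma boundary_of_single j i :
  boundaries (row i (U 2 ([set j]%SET, 1) *m d 1)).
Proof.
rewrite U_lift /tate_action /= cards1 expr1 scaleN1r (bigD1 j) //= big1 => [|l nlj].
  rewrite addr0 /flip /flip_coef inE eqxx finset.setDv U_id sign_before_notin => [|l].
    rewrite mul1r addrC (_ : row i _ = x j 0 *: delta_mx 0 i - x i 0 *: generator_lift j).
      rewrite -(subrK (x j 0 *: generator_lift i) (x j 0 *: delta_mx 0 i)) -addrA.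
      apply: (submoduleD (span_submodule _)); last exact: koszul_generator_lift.
      rewrite -scalerBr -opprB scalerN -scaleNr; apply: span_in; right.
      exists (- x j 0), (generator_lift i - delta_mx 0 i); split=> //.
        by apply: (submoduleN (local_ideal hR)); apply: (minimal_diff hd).
      exact: generator_lift_syzygy.
    apply/rowP => k; rewrite !mxE big_ord1; congr (_ * _ - _ * _).
    by rewrite eqxx eq_sym.
  by rewrite inE => /eqP->.
rewrite U_off ?scaler0 // /off_degree card_flip inE (negPf nlj) cards1.
by lia.
Qed.

Lemma boundary_of_pair (j l : 'I_e) i : (j < l)%N ->
  boundaries (row i (U 2 ([set j; l]%SET, 0) *m d 1)).
Proof.
move=> ltjl; have nlj : l != j by rewrite neq_ltn ltjl orbT.
rewrite U_lift /tate_action /= scaler0 add0r (bigD1 j) //= (bigD1 l) //= big1 => [|k]; last first.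
  case/andP=> nkj nkl; rewrite U_off ?scaler0 // /off_degree card_flip !inE.
  by rewrite (negPf nkj) (negPf nkl) cards2 (eq_sym j) nlj.
have -> : flip j [set j; l]%SET = [set l]%SET.
  apply/setP => k; rewrite in_flip !inE; have [->|nkj] := eqVneq k j.
    by rewrite eq_sym (negPf nlj).
  by rewrite addbF.
have -> : flip l [set j; l]%SET = [set j]%SET.
  apply/setP => k; rewrite in_flip !inE; have [->|nkl] := eqVneq k l.
    by rewrite orbT (negPf nlj).
  by rewrite orbF addbF.
have s0 : flip_coef d c l [set j; l]%SET = - x l 0.
  rewrite /flip_coef !inE eqxx orbT /sign_before.
  rewrite (_ : [set k in _ | _]%SET = [set j]%SET) ?cards1 ?mulN1r //.
  apply/setP => k; rewrite !inE; have [->|nkj] := eqVneq k j; first by rewrite ltjl.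
  by case: eqVneq => // ->; rewrite ltnn.
rewrite s0 /flip_coef !inE eqxx sign_before_notin => [|k]; last first.
  by rewrite !inE => /orP[]/eqP-> //; apply: ltnW.
rewrite mul1r addr0 scaleNr (_ : row i _ = x j 0 *: generator_lift l - x l 0 *: generator_lift j).
  exact: koszul_generator_lift.
by apply/rowP => k; rewrite !mxE !ord1.
Qed.

Lemma boundary_of_Y : boundaries ((U 2 (finset.set0, 0) : 'rV_(_)) *m d 1 - c).
Proof.
rewrite [X in X - _](U_lift 1 (finset.set0, 0)) /tate_action /= scaler0 add0r.
rewrite {1}[c in _ - c]row_sum_delta -sumrB.
apply: (submodule_sum (span_submodule _)) => j _.
rewrite /flip_coef /flip inE finset.setU0 sign_before_notin => [|k]; last by rewrite inE.
rewrite mul1r -scalerBr; apply: span_in; right; exists (c 0 j), (generator_lift j - delta_mx 0 j).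
split=> //; last exact: generator_lift_syzygy.
exact: (syzygy_in hR hd syz_c).
Qed.

Variable f : 'M[R]_(a 2, a 0).
Hypothesis f_boundary : forall v : 'rV_(a 2),
  boundaries (v *m d 1) -> in_ideal m (v *m f).
Hypothesis f_Y : in_ideal m (U 2 (finset.set0, 0) *m f - 1%:M).
Variable theta : forall n, 'M[R]_(a n.+2, a n).
Hypothesis theta0 : theta 0 = f.
Hypothesis theta_chain : forall n, theta n.+1 *m d n = d n.+2 *m theta n.

Definition after_theta k (Y : forall p, 'M[R]_(a p, k)) p : 'M[R]_(a p, k) :=
  match p with p'.+2 => theta p' *m Y p' | _ => 0 end.

Lemma after_theta_tate k (X : tate_family k) S p :
  tate_action d c (fun Sp => after_theta (fun p => X (Sp.1, p)) Sp.2) (S, p) =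
  after_theta (fun p => tate_action d c X (S, p)) p.
Proof.
rewrite /tate_action /=; case: p => [|[|p]] /=.
- by rewrite scaler0 add0r big1 // => j _; rewrite scaler0.
- by rewrite mulmx0 scaler0 add0r big1 // => j _; rewrite scaler0.
rewrite mulmxDr mulmx_sumr -scalemxAr; congr (_ *: _ + _).
  by case: p => [|p] /=; rewrite ?mulmx0 // !mulmxA theta_chain.
by apply: eq_bigr => j _; rewrite -scalemxAr.
Qed.

(** The failure of the relation [theta Y^(i+1) = Y^(i) + Y^(i+1) theta], after
    multiplication by [X_S].  Raising the target degree by two while keeping
    [(S, p)] raises the exponent of [Y] by one, and matrices compose from left
    to right. *)
Definition commutator_defect n : tate_family (a n) := fun Sp =>
  U n.+2 Sp *m theta n - after_theta (fun p => U n (Sp.1, p)) Sp.2 - U n Sp.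

Lemma commutator_defect_lift n Sp :
  commutator_defect n.+1 Sp *m d n = tate_action d c (commutator_defect n) Sp.
Proof.
have E1 : U n.+3 Sp *m theta n.+1 *m d n = tate_action d c (U n.+2) Sp *m theta n.
  by rewrite -mulmxA theta_chain mulmxA U_lift.
have E2 : after_theta (fun p => U n.+1 (Sp.1, p)) Sp.2 *m d n =
    tate_action d c (fun Sp => after_theta (fun p => U n (Sp.1, p)) Sp.2) Sp.
  case: Sp {E1} => S p; rewrite after_theta_tate /=.
  case: p => [|[|p]] /=; rewrite ?mul0mx // -mulmxA; congr (_ *m _).
  exact: (U_lift n (S, p)).
by rewrite /commutator_defect !mulmxBl E1 E2 U_lift !tate_actionB tate_actionM.
Qed.

Lemma boundary_rows p (A : 'M[R]_(p, a 2)) :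
  (forall i, boundaries (row i (A *m d 1))) -> in_ideal m (A *m f).
Proof.
move=> hA i j; have := f_boundary (v := row i A); rewrite -!row_mul => /(_ (hA i)).
by move=> /(_ 0 j); rewrite mxE.
Qed.

(** In total degree 2 the defect is determined by the values of [f] on [Y], on the
    products [X_j X_l], and on the products of [X_j] with degree 1. *)
Lemma commutator_defect0 Sp : in_ideal m (commutator_defect 0 Sp).
Proof.
case: Sp => S p; rewrite /commutator_defect /= theta0 U_0.
have [off|] := boolP (off_degree 2 S p).
  rewrite U_off // mul0mx sub0r unit_family0; last first.
    by move: off; case: eqP => //= ->; rewrite /off_degree cards0; case: p.
  rewrite subr0; apply: (in_idealN hR).
  case: p off => [|[|p]] off /=; try exact: (in_ideal0 hR).
  rewrite unit_family0 ?mulmx0; first exact: (in_ideal0 hR).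
  by move: off; case: eqP => //= ->; rewrite /off_degree cards0; case: p.
rewrite /off_degree negb_or -leqNgt => /andP[le2 even].
have : (#|S| = 0 /\ p = 0 \/ #|S| = 0 /\ p = 2 \/ #|S| = 1 /\ p = 1 \/
        #|S| = 2 /\ p = 0)%N by move: #|S| le2 even => s; lia.
case=> [|[|[|]]].
- move=> [/eqP]; rewrite cards_eq0 => /eqP-> ->; rewrite /= subr0 unit_family_id.
  exact: f_Y.
- move=> [/eqP]; rewrite cards_eq0 => /eqP-> ->; rewrite /= U_id unit_family_id.
  rewrite theta0 mul1mx mulmx1 subrr sub0r.
  apply: (in_idealN hR); rewrite unit_family0 ?orbT //; exact: (in_ideal0 hR).
- move=> [/eqP/cards1P[j ->] ->]; rewrite /= unit_family0 ?orbT // !subr0.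
  by apply: boundary_rows => i; apply: boundary_of_single.
move=> [/eqP/cards2P[j [l [njl ->]]] ->]; rewrite /= unit_family0 ?subr0; last first.
  by rewrite orbF -card_gt0 cards2 njl.
apply: boundary_rows => i; move: njl; rewrite neq_ltn => /orP[] lt.
  exact: boundary_of_pair.
by rewrite finset.setUC; apply: boundary_of_pair.
Qed.

(** For [n = p] the matrix [W] is the alternating sum of the [Y^(i+1) theta^i], which
    the commutator relation turns into a telescoping sum; divided powers make it
    work in every characteristic. *)
Lemma right_inverse_mod n p :
  exists W : 'M_(a p, a n.+2), in_ideal m (W *m theta n - U n (finset.set0, p)).
Proof.
have defect q : in_ideal m (commutator_defect n (finset.set0, q)).
  apply: (family_in_ideal hR hd (tate_actionM d c) (tate_actionB d c)
    (tate_actionK hd syz_c) (@tate_action_in _ _ hR _ _ hd _ syz_c)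
    commutator_defect_lift commutator_defect0).
have [k] := ubnP p; elim: k p => // k IH [|[|p]] ltpk.
- by exists (U n.+2 (finset.set0, 0)); have := defect 0; rewrite /commutator_defect /= subr0.
- by exists (U n.+2 (finset.set0, 1)); have := defect 1; rewrite /commutator_defect /= subr0.
have [|W hW] := IH p; first by rewrite ltnS in ltpk; apply: ltnW.
exists (U n.+2 (finset.set0, p.+2) - theta p *m W).
have -> : (U n.+2 (finset.set0, p.+2) - theta p *m W) *m theta n - U n (finset.set0, p.+2) =
    commutator_defect n (finset.set0, p.+2)
      - theta p *m (W *m theta n - U n (finset.set0, p)).
  rewrite /commutator_defect /= mulmxBl mulmxBr mulmxA opprB.
  by rewrite [RHS]addrACA subrK addrA addrAC.
by apply: (in_idealB hR); [apply: defect | apply: (in_ideal_mull hR)].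
Qed.

End Operators.

(** On a Tate resolution [theta] would be the derivation dual to the variable [Y]
    of degree 2 that kills the cycle [c].  Here [theta] is determined by its
    component [f] from degree 2 to degree 0, which must send [Y] to 1 and the
    products of elements of degree 1 to 0 modulo [m].  Such an [f] exists because
    the differential sends these products to trivial syzygies, and [Y] to [c]
    up to trivial ones. *)
Lemma exists_surjective_degree2_operator :
  ~ trivial_mod_m m x c ->
  exists theta : forall n, 'M[R]_(a n.+2, a n),
    (forall n, theta n.+1 *m d n = d n.+2 *m theta n) /\
    forall n, exists W : 'M_(a n, a n.+2), in_ideal m (W *m theta n - 1%:M).
Proof.
move=> nc; have [U [U_lift U_0 U_off U_id]] := exists_tate_operators.
pose u : 'rV_(a 2) := U 2 (finset.set0, 0).
pose B := trivial_mod_m m x.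
have [|r v mr|uB|f [fW fu]] := separating_functional hR (W := fun v => B (v *m d 1)) (u := u).
- have [B0 BD] : submodule B by apply: span_submodule.
  split=> [|r v w Bv Bw]; first by rewrite mul0mx.
  by rewrite mulmxDl -scalemxAl; apply: BD.
- rewrite -scalemxAl; apply: span_in; right; exists r, (v *m d 1); split=> //.
  by rewrite /syzygy -mulmxA (minimal_complex hd) mulmx0.
- apply: nc; rewrite -[c](subKr (u *m d 1)).
  apply: (submoduleB (span_submodule _)) => //.
  exact: boundary_of_Y.
have [theta [theta0 theta_chain]] := exists_degree2_operator hR hd f.
exists theta; split=> // n.
have [W hW] := right_inverse_mod U_lift U_0 U_off U_id fW fu theta0 theta_chain n n.
by exists W; rewrite -(U_id n).
Qed.

End TateModule.

(** * Tensor products with the resolution *)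

Section MatrixAction.
Variables (R : comNzRingType) (M : lmodType R).

Definition mact p q (A : 'M[R]_(p, q)) (v : 'I_q -> M) : 'I_p -> M :=
  fun i => \sum_j A i j *: v j.

Lemma mactM p q r (A : 'M_(p, q)) (B : 'M_(q, r)) v :
  mact (A *m B) v = mact A (mact B v).
Proof.
apply/funext => i; rewrite /mact; under eq_bigr do rewrite mxE scaler_suml.
rewrite exchange_big /=; apply: eq_bigr => j _.
by rewrite scaler_sumr; apply: eq_bigr => k _; rewrite scalerA.
Qed.

Lemma mactDl p q (A B : 'M_(p, q)) v i : mact (A + B) v i = mact A v i + mact B v i.
Proof. by rewrite -big_split /=; apply: eq_bigr => j _; rewrite mxE scalerDl. Qed.

Lemma mactDr p q (A : 'M_(p, q)) v w i :
  mact A (fun j => v j + w j) i = mact A v i + mact A w i.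
Proof. by rewrite -big_split /=; apply: eq_bigr => j _; rewrite scalerDr. Qed.

Lemma mactBr p q (A : 'M_(p, q)) v w i :
  mact A (fun j => v j - w j) i = mact A v i - mact A w i.
Proof. by rewrite -sumrB; apply: eq_bigr => j _; rewrite scalerBr. Qed.

Lemma mact0 p q (v : 'I_q -> M) (i : 'I_p) : mact 0 v i = 0.
Proof. by rewrite /mact big1 // => j _; rewrite mxE scale0r. Qed.

Lemma mact0r p q (A : 'M_(p, q)) i : mact A (fun=> 0) i = 0.
Proof. by rewrite /mact big1 // => j _; rewrite scaler0. Qed.

End MatrixAction.

Lemma mact_linear (R : comNzRingType) (M N : lmodType R) (f : {linear M -> N}) p q
    (A : 'M_(p, q)) (v : 'I_q -> M) i :
  f (mact A v i) = mact A (fun j => f (v j)) i.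
Proof. by rewrite linear_sum; apply: eq_bigr => j _; rewrite linearZ. Qed.

Section FiniteSupport.
Variables (R : comNzRingType) (Q : lmodType R).

Definition finite_support : {pred Q -> R^o} :=
  fun phi => `[< exists s : seq Q, forall q, phi q != 0 -> q \in s >].

Fact finite_support_submod : GRing.subsemimod_closed finite_support.
Proof.
split; first split.
- by apply/asboolP; exists [::] => q; rewrite eqxx.
- move=> f g /asboolP[s hs] /asboolP[t ht]; apply/asboolP; exists (s ++ t) => q.
  rewrite mem_cat fctE => fg; apply/orP.
  have [fq|/hs] := eqVneq (f q) 0; last by left.
  by right; apply: ht; move: fg; rewrite fq add0r.
- move=> r f /asboolP[s hs]; apply/asboolP; exists s => q; rewrite fctE => rf.
  by apply: hs; apply: contraNneq rf => ->; rewrite scaler0.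
Qed.

HB.instance Definition _ :=
  GRing.isSubmodClosed.Build R (Q -> R^o) finite_support finite_support_submod.

(** The free module on the underlying set of [Q]. *)
Record free_module := FreeModule {
  free_coef :> Q -> R^o;
  free_coefP : free_coef \in finite_support
}.

HB.instance Definition _ := [isSub for free_coef].
HB.instance Definition _ := [Choice of free_module by <:].
HB.instance Definition _ := [SubChoice_isSubLmodule of free_module by <:].

Lemma free_coefD r (f g : free_module) q :
  free_coef (r *: f + g) q = r * f q + g q.
Proof. by []. Qed.

Definition free_supp (phi : free_module) : seq Q :=
  undup (sval (cid (asboolP _ (free_coefP phi)))).

Lemma mem_free_supp (phi : free_module) q : phi q != 0 -> q \in free_supp phi.
Proof. by rewrite mem_undup; case: cid => s hs /= /hs. Qed.

Definition free_eval (phi : free_module) : Q := \sum_(q <- free_supp phi) phi q *: q.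

Lemma free_evalE (phi : free_module) (s : seq Q) :
  uniq s -> (forall q, phi q != 0 -> q \in s) ->
  free_eval phi = \sum_(q <- s) phi q *: q.
Proof.
have support_sum t : \sum_(q <- t) phi q *: q =
    \sum_(q <- [seq q <- t | phi q != 0]) phi q *: q.
  rewrite big_filter [LHS](bigID (fun q => phi q != 0)) /= [X in _ + X]big1 ?addr0 //.
  by move=> q; rewrite negbK => /eqP->; rewrite scale0r.
move=> uniq_s hs; rewrite /free_eval support_sum [RHS]support_sum; apply: perm_big.
apply: uniq_perm; rewrite ?filter_uniq ?undup_uniq // => q; rewrite !mem_filter.
by case: eqP => //= /eqP nz; rewrite mem_free_supp // hs.
Qed.

Lemma free_eval_linear : linear free_eval.
Proof.
move=> r f g; pose s := undup (free_supp f ++ free_supp g).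
have us : uniq s by apply: undup_uniq.
have fs q : f q != 0 -> q \in s.
  by move=> /mem_free_supp fq; rewrite /s mem_undup mem_cat fq.
have gs q : g q != 0 -> q \in s.
  by move=> /mem_free_supp gq; rewrite /s mem_undup mem_cat gq orbT.
rewrite (free_evalE us fs) (free_evalE us gs) (free_evalE us (phi := r *: f + g)).
  rewrite scaler_sumr -big_split /=; apply: eq_bigr => q _.
  by rewrite scalerA -scalerDl.
move=> q; have [fq|/fs //] := eqVneq (f q) 0.
by rewrite free_coefD fq mulr0 add0r; apply: gs.
Qed.

HB.instance Definition _ :=
  GRing.isLinear.Build R free_module Q *:%R free_eval free_eval_linear.

Definition free_coef_at q (phi : free_module) : R^o := phi q.

Lemma free_coef_at_linear q : linear (free_coef_at q).
Proof. by move=> r f g; apply: free_coefD. Qed.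

HB.instance Definition _ q :=
  GRing.isLinear.Build R free_module R^o *:%R (free_coef_at q) (free_coef_at_linear q).

Lemma free_eval_surj q : exists phi, free_eval phi = q.
Proof.
have supp_q : (fun q' => (q' == q)%:R : R^o) \in finite_support.
  apply/asboolP; exists [:: q] => q'; rewrite inE.
  by have [//|_ /eqP[]] := eqVneq q' q.
exists (FreeModule supp_q); rewrite (free_evalE (s := [:: q])) //.
  by rewrite big_seq1 /= eqxx scale1r.
move=> q'; rewrite inE /=; have [//|_ /eqP[]] := eqVneq q' q.
by [].
Qed.

End FiniteSupport.

Section Pullback.
Variables (R : comNzRingType) (X Y Z : lmodType R).
Variables (d : {linear Y -> Z}) (f : {linear X -> Z}).

Definition in_pullback : {pred X * Y} := fun xy => d xy.2 == f xy.1.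

Fact in_pullback_submod : GRing.subsemimod_closed in_pullback.
Proof.
split; first split.
- by rewrite unfold_in /= !linear0.
- by move=> u v /eqP hu /eqP hv; rewrite unfold_in /= !linearD hu hv.
- by move=> r u /eqP hu; rewrite unfold_in /= !linearZ hu.
Qed.

HB.instance Definition _ :=
  GRing.isSubmodClosed.Build R (X * Y)%type in_pullback in_pullback_submod.

Record pullback := Pullback {
  pullback_pair :> X * Y;
  pullbackP : pullback_pair \in in_pullback
}.

HB.instance Definition _ := [isSub for pullback_pair].
HB.instance Definition _ := [Choice of pullback by <:].
HB.instance Definition _ := [SubChoice_isSubLmodule of pullback by <:].

(** The pullback of [d] along [f] is a surjection onto [X], hence has a section. *)
Lemma projective_lift : projective X -> (forall x, exists y, d y = f x) ->
  exists h : {linear X -> Y}, forall x, d (h x) = f x.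
Proof.
move=> projX hsurj.
have p1l : linear (fun u : pullback => u.1) by [].
have p2l : linear (fun u : pullback => u.2) by [].
pose p1 := HB.pack_for {linear pullback -> X} (fun u : pullback => u.1)
  (GRing.isLinear.Build R _ _ _ _ p1l).
pose p2 := HB.pack_for {linear pullback -> Y} (fun u : pullback => u.2)
  (GRing.isLinear.Build R _ _ _ _ p2l).
have [|h hh] := projX pullback X p1 idfun.
  move=> x; have [y yE] := hsurj x.
  have xy : (x, y) \in in_pullback by apply/eqP.
  by exists (Pullback xy).
exists (p2 \o h) => x; have /eqP/= := pullbackP (h x).
by move=> ->; congr (f _); apply: hh.
Qed.

End Pullback.

Section TorVanishing.
Variables (R : comNzRingType) (m : {pred R}) (hR : local_ring m).
Variables (b : nat -> nat) (d : forall n, 'M[R]_(rank_of b n.+1, rank_of b n)).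
Hypothesis hd : minimal_resolution m d.
Local Notation a := (rank_of b).

(** The complex [A (x) M] is exact in degree [i + 1], where [A] is the
    resolution; that is, [Tor_(i+1)(k, M) = 0]. *)
Definition tor_vanishes (M : lmodType R) i :=
  forall w : 'I_(a i.+1) -> M, (forall j, mact (d i)^T w j = 0) ->
  exists v : 'I_(a i.+2) -> M, forall j, w j = mact (d i.+1)^T v j.

(** The equations are solved one basis element of the free module at a time, by
    zero wherever possible, so that the supports of the solutions stay finite. *)
Lemma free_tor_vanishes (Q : lmodType R) i : tor_vanishes (free_module Q) i.
Proof.
move=> w hw.
have row_eq q : exists v : 'rV_(a i.+2), v *m d i.+1 = \row_j (w j q : R) /\
    ((forall j, w j q = 0) -> v = 0).
  have [w0|nw0] := pselect (forall j, w j q = 0).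
    by exists 0; split=> //; apply/rowP => j; rewrite mul0mx !mxE w0.
  have [|v vE] := minimal_exact hd (n := i) (A := \row_j (w j q : R)).
    apply/rowP => k; rewrite mxE [RHS]mxE.
    transitivity (free_coef_at q (mact (d i)^T w k)); last by rewrite hw.
    by rewrite mact_linear; apply: eq_bigr => j _; rewrite !mxE; exact: mulrC.
  by exists v; split=> // w0; case: nw0.
pose v q := sval (cid (row_eq q)).
have v_supp k : (fun q => v q 0 k : R^o) \in @finite_support R Q.
  apply/asboolP; exists (flatten [seq free_supp (w j) | j <- enum 'I_(a i.+1)]) => q.
  move=> nz; apply/flatten_mapP; apply: contrapT => nex; move/eqP: nz; apply.
  rewrite /v (svalP (cid (row_eq q))).2 ?mxE // => j.
  apply: contrapT => /eqP/mem_free_supp wjq; apply: nex.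
  by exists j; rewrite ?mem_enum.
exists (fun k => FreeModule (v_supp k)) => j; apply/val_inj/funext => q.
have /rowP/(_ j) := (svalP (cid (row_eq q))).1; rewrite mxE [RHS]mxE => wE.
change (free_coef_at q (w j) =
  free_coef_at q (mact (d i.+1)^T (fun k => FreeModule (v_supp k)) j)).
rewrite mact_linear -[LHS]wE; apply: eq_bigr => k _.
by rewrite mxE; exact: mulrC.
Qed.

(** A projective module is a direct summand of a free one. *)
Lemma projective_tor_vanishes (Q : lmodType R) i : projective Q -> tor_vanishes Q i.
Proof.
move=> projQ w hw.
have [|s hs] := projQ _ _ (free_eval (Q := Q)) idfun; first exact: free_eval_surj.
have [|v vE] := free_tor_vanishes (w := fun j => s (w j)).
  by move=> j; rewrite -mact_linear hw linear0.
exists (fun k => free_eval (v k)) => j; rewrite -mact_linear -vE; exact/esym/hs.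
Qed.

Lemma mact_complex (M : lmodType R) i (v : 'I_(a i.+2) -> M) j :
  mact (d i)^T (mact (d i.+1)^T v) j = 0.
Proof. by rewrite -mactM -trmx_mul (minimal_complex hd) trmx0 mact0. Qed.

Lemma finite_proj_dim_tor_vanishes (F : lmodType R) :
  finite_proj_dim F -> exists N, forall i, (N <= i)%N -> tor_vanishes F i.
Proof.
move=> [Q [N QN]]; pose D := res_diff Q.
have DD n (y : Q n.+2) : D n (D n.+1 y) = 0 by apply/res_exact; exists y.
(* Descending through the resolution, a class of [Tor] moves to lower degrees. *)
have step l : (l <= N.+1)%N -> forall i, (N.+1 <= i + l)%N ->
    forall (w : 'I_(a i.+1) -> Q l) (w' : 'I_(a i) -> Q l.+1),
    (forall j, mact (d i)^T w j = D l (w' j)) ->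
  exists v : 'I_(a i.+2) -> Q l, exists v' : 'I_(a i.+1) -> Q l.+1,
    forall j, w j = mact (d i.+1)^T v j + D l (v' j).
  move: l; apply: downward_ind => [i _ w w' _|l ltlN IH i leN w w' hw].
    exists (fun=> 0), (fun=> 0) => j; rewrite mact0r linear0 addr0.
    exact: (QN N.+1 (leqnn _)).
  case: i => [|i] in leN w w' hw *.
    by move: leN; rewrite add0n leqNgt ltlN.
  have dw' j : exists z, D l.+1 z = mact (d i)^T w' j.
    apply/res_exact; rewrite [res_diff _ _ _](mact_linear (D l)).
    transitivity (mact (d i)^T (mact (d i.+1)^T w) j); last exact: mact_complex.
    by apply: eq_bigr => k _; rewrite hw.
  have [||v' [w'' w'E]] := IH i _ w' (fun j => sval (cid (dw' j))).
  - by rewrite addnS -addSn.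
  - by move=> j; case: cid => z /= ->.
  have [|v vE] := projective_tor_vanishes (@res_projective R F Q l)
    (w := fun j => w j - D l (v' j)).
    move=> j; rewrite mactBr hw -mact_linear w'E linearD DD addr0.
    by rewrite subrr.
  by exists v, v' => j; rewrite -vE subrK.
exists N.+1 => i leN w hw.
pose w0 j := sval (cid (res_aug_surj Q (w j))).
have w0E j : res_aug Q (w0 j) = w j by rewrite /w0; case: cid.
have dw0 j : exists z, D 0 z = mact (d i)^T w0 j.
  apply/res_exact0; rewrite mact_linear -[RHS](hw j).
  by apply: eq_bigr => k _; rewrite w0E.
have [|||v [v' vE]] := step 0 _ i _ w0 (fun j => sval (cid (dw0 j))) => //.
- by rewrite addn0.
- by move=> j; case: cid.
exists (fun k => res_aug Q (v k)) => j; rewrite -mact_linear -w0E vE linearD.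
by rewrite (_ : res_aug Q (D 0 _) = 0) ?addr0 //; apply/res_exact0; exists (v' j).
Qed.

End TorVanishing.

(** * Vanishing modulo the maximal ideal *)

Section Staircases.
Variables (R : comNzRingType) (m : {pred R}) (hR : local_ring m).
Variables (b : nat -> nat) (d : forall n, 'M[R]_(rank_of b n.+1, rank_of b n)).
Hypothesis hd : minimal_resolution m d.
Local Notation a := (rank_of b).

(** The components [Z j i] in [A_i (x) A_j] of a cycle of the total complex of
    [A (x) A], where [A] is the resolution; since [A] is minimal one can treat
    the cycles of all degrees at once. *)
Definition staircase (Z : forall j i, 'M[R]_(a i, a j)) : Prop :=
  forall j i, Z j.+1 i *m d j = (d i)^T *m Z j i.+1.

Definition after_coboundary c (X : family R a c) : family R a c :=
  fun i => (d i)^T *m X i.+1.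

Lemma after_coboundaryM c c' (X : family R a c) (D : 'M_(c, c')) i :
  after_coboundary (fun i => X i *m D) i = after_coboundary X i *m D.
Proof. exact: mulmxA. Qed.

Lemma after_coboundaryB c (X Y : family R a c) i :
  after_coboundary (fun i => X i - Y i) i = after_coboundary X i - after_coboundary Y i.
Proof. exact: mulmxBr. Qed.

Lemma after_coboundaryK c (X : family R a c) i :
  after_coboundary (after_coboundary X) i = 0.
Proof. by rewrite /after_coboundary mulmxA -trmx_mul (minimal_complex hd) trmx0 mul0mx. Qed.

Lemma after_coboundary_in c (X : family R a c) i : in_ideal m (after_coboundary X i).
Proof.
by apply: (in_ideal_mulr hR) => j k; rewrite mxE; apply: (minimal_diff hd).
Qed.

Lemma exists_staircase (z : forall i, 'M[R]_(a i, a 0)) :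
  exists Z, staircase Z /\ forall i, Z 0 i = z i.
Proof.
have [Z [Z0 hZ]] := lift_family hd after_coboundaryM after_coboundaryK
  after_coboundary_in z (fun n i => 0).
by exists Z; split=> [j i|i]; [apply: (hZ j i).1 | rewrite Z0].
Qed.

Lemma exists_staircase_row (z : forall j, 'M[R]_(a 0, a j)) :
  exists Z, staircase Z /\ forall j, Z j 0 = z j.
Proof.
have [Z [hZ Z0]] := exists_staircase (fun j => (z j)^T).
exists (fun j i => (Z i j)^T); split=> [j i|j]; last by rewrite Z0 trmxK.
by apply: trmx_inj; rewrite !trmx_mul !trmxK hZ.
Qed.

Variable theta : forall n, 'M[R]_(a n.+2, a n).
Hypothesis theta_chain : forall n, theta n.+1 *m d n = d n.+2 *m theta n.
Hypothesis theta_surj : forall n,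
  exists W : 'M_(a n, a n.+2), in_ideal m (W *m theta n - 1%:M).

(** A staircase is determined up to homotopy by its values modulo [m] in the column
    [j = 0], where [theta] is surjective. *)
Lemma staircase_theta Z : staircase Z -> exists Y, staircase Y /\
  exists H : forall j i, 'M_(a i, a j), forall j i,
    Z j i = (theta i)^T *m Y j i.+2 + H j.+1 i *m d j + (d i)^T *m H j i.+1.
Proof.
move=> hZ; pose W n := sval (cid (theta_surj n)).
have hW n : in_ideal m (W n *m theta n - 1%:M) by rewrite /W; case: cid.
have [Y [hY Y0]] := exists_staircase (fun q => match q return 'M_(a q, a 0) with
  | i.+2 => (W i)^T *m Z 0 i | _ => 0 end).
exists Y; split=> //.
have [|i|H EH] := homotopy_family hR hd after_coboundaryM after_coboundaryB
  after_coboundaryK after_coboundary_in (E := fun j i => Z j i - (theta i)^T *m Y j i.+2).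
- move=> j i; rewrite /after_coboundary mulmxBl mulmxBr hZ -!mulmxA hY.
  by rewrite !mulmxA -!trmx_mul theta_chain.
- rewrite Y0 mulmxA -trmx_mul -[X in X - _]mul1mx -mulmxBl.
  apply: (in_ideal_mulr hR) => k l; rewrite -opprB mxE.
  apply: (submoduleN (local_ideal hR)).
  by have := hW i l k; rewrite !mxE eq_sym.
exists H => j i; have := EH j i; rewrite -addrA => <-.
by rewrite addrC subrK.
Qed.

Section Cocycle.
Variables (M : lmodType R) (N n : nat) (f : 'I_(a n) -> M).
Hypothesis torM : forall i, (N <= i)%N -> tor_vanishes d M i.
Hypothesis f_cocycle : forall j, mact (d n) f j = 0.

(** The class of [Z] in [Tor_i(k, M)] is the image under a power of [theta] of a
    class in a degree where [Tor(k, M)] vanishes. *)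
Lemma staircase_boundary l i Z : staircase Z -> (N < i + l.*2)%N ->
  exists v, forall j, mact (Z n i) f j = mact (d i)^T v j.
Proof.
have mact_f0 p (A : 'M_(p, _)) j : mact A (mact (d n) f) j = 0.
  rewrite -[RHS](mact0r M A j); congr (mact A _ j).
  by apply/funext => k; rewrite f_cocycle.
elim: l i Z => [|l IH] i Z hZ.
  rewrite addn0; case: i => // i leNi; apply: (torM leNi) => j.
  by rewrite -mactM -hZ mactM mact_f0.
rewrite doubleS !addnS -!addSn => ltN; have [Y [hY [H ZE]]] := staircase_theta hZ.
have [v vE] := IH i.+2 Y hY ltN.
exists (fun k => mact (theta i.+1)^T v k + mact (H n i.+1) f k) => j.
rewrite ZE !mactDl !mactM mact_f0 addr0 mactDr -!mactM; congr (_ + _).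
rewrite -trmx_mul theta_chain trmx_mul !mactM; congr (mact _ _ j).
by apply/funext => k; rewrite vE.
Qed.

(** In degree 0 the boundaries of [A (x) M] are the elements of [m M]. *)
Lemma cocycle_in_mM (k : 'I_(a n)) :
  exists v : 'I_(a 1) -> M, f k = mact (d 0)^T v 0.
Proof.
have [Z [hZ Z0]] := exists_staircase_row (fun j =>
  \matrix_(_, l) ((j == n) && (l == k :> nat))%:R).
have [|v vE] := staircase_boundary (l := N.+1) (i := 0) hZ.
  by rewrite add0n -addnn; lia.
exists v; rewrite -vE Z0 /mact (bigD1 k) //= big1 => [|l]; last first.
  by rewrite -val_eqE /= => /negPf nlk; rewrite mxE nlk andbF scale0r.
by rewrite mxE !eqxx scale1r addr0.
Qed.

End Cocycle.
End Staircases.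

(** * Comparison with an arbitrary projective resolution *)

Section Comparison.
Local Open Scope quotient_scope.
Variables (R : comNzRingType) (m : idealr R) (hR : local_ring m).
Variables (b : nat -> nat) (d : forall n, 'M[R]_(rank_of b n.+1, rank_of b n)).
Hypothesis hd : minimal_resolution m d.
Local Notation a := (rank_of b).
Variable P : proj_resolution (residue_field m).

Local Notation D := (res_diff P).
Local Notation aug := (res_aug P).

Lemma residue_scale_eq0 (r : R) : r *: (1 : residue_field m) = 0 <-> r \in m.
Proof.
have -> : r *: (1 : residue_field m) = \pi_{ideal_quot m} r by exact: mulr1.
rewrite -[r in r \in m]subr0 (Quotient.idealrBE m).
have -> : (0 : residue_field m) = \pi_{ideal_quot m} 0 by rewrite rmorph0.
by split=> [->|/eqP].
Qed.

Lemma residue_generated (t : residue_field m) : exists r : R, r *: (1 : residue_field m) = t.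
Proof. by exists (repr t); rewrite -[RHS]reprK; exact: mulr1. Qed.

Lemma exists_comparison_to : exists u : forall n, 'I_(a n) -> P n,
  aug (u 0 0) = 1 /\ forall n j, D n (u n.+1 j) = mact (d n) (u n) j.
Proof.
have [u0 u0E] := res_aug_surj P 1.
pose Kc n (y : P n) : Prop := match n return P n -> Prop with
  | 0 => fun y => aug y = 0 | n'.+1 => fun y => D n' y = 0 end y.
have exactK n (y : P n) : Kc n y -> exists z, D n z = y.
  by case: n y => [|n] y; [move/res_exact0 | move/res_exact].
have [j|n u hu|u [u_0 hu]] := dependent_choice (T := fun n => 'I_(a n) -> P n)
  (P := fun n u => forall j, Kc n (mact (d n) u j))
  (Q := fun n u u' => forall j, D n (u' j) = mact (d n) u j) (t0 := fun=> u0).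
- rewrite /= mact_linear /mact big_ord1 u0E; apply/residue_scale_eq0.
  exact: (minimal_diff hd).
- exists (fun j => sval (cid (exactK n _ (hu j)))); split=> j; last by case: cid.
  rewrite /= mact_linear -[RHS](mact0 u j) -(minimal_complex hd) mactM.
  by apply: eq_bigr => k _; case: cid => z /= ->.
exists u; split; first by rewrite u_0.
by move=> n; apply: (hu n).2.
Qed.

Lemma exists_comparison_from : exists v : forall n, {linear P n -> 'rV[R]_(a n)},
  (forall y, v 0 y 0 0 *: (1 : residue_field m) = aug y) /\
  forall n y, v n.+1 y *m d n = v n (D n y).
Proof.
pose pf (w : 'rV[R]_(a 0)) := w 0 0 *: (1 : residue_field m).
have pl : linear pf by move=> r w w'; rewrite /pf !mxE scalerDl scalerA.
pose p := HB.pack_for {linear 'rV[R]_(a 0) -> residue_field m} pf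
  (GRing.isLinear.Build R _ _ _ pf pl).
have [y|v0 v0E] := projective_lift (d := p) (f := aug) (@res_projective _ _ P 0).
  by have [r rE] := residue_generated (aug y); exists (const_mx r); rewrite /= /pf mxE.
have [z|n v hv|v [v_0 hv]] := dependent_choice (T := fun n => {linear P n -> 'rV[R]_(a n)})
  (P := fun n v => forall z, exists w, w *m d n = v (D n z))
  (Q := fun n v v' => forall y, v' y *m d n = v (D n y)) (t0 := v0).
- apply: (minimal_aug hd) => i j; rewrite !ord1; apply/residue_scale_eq0.
  by rewrite [LHS]v0E; apply/res_exact0; exists z.
- have [v' v'E] := projective_lift (d := mulmxr (d n)) (f := v \o D n)
    (@res_projective _ _ P n.+1) hv.
  exists v'; split=> // z; apply: (minimal_exact hd).
  have DD : D n (D n.+1 z) = 0 by apply/res_exact; exists z.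
  by have /= -> := v'E (D n.+1 z); rewrite DD linear0.
exists v; split=> [y|n y]; last exact: (hv n).2.
by rewrite v_0; apply: v0E.
Qed.

Lemma exists_comparison_homotopy (u : forall n, 'I_(a n) -> P n)
    (v : forall n, {linear P n -> 'rV[R]_(a n)}) :
    aug (u 0 0) = 1 -> (forall n j, D n (u n.+1 j) = mact (d n) (u n) j) ->
    (forall y, v 0 y 0 0 *: (1 : residue_field m) = aug y) ->
    (forall n y, v n.+1 y *m d n = v n (D n y)) ->
  exists h : forall n, {linear P n -> P n.+1},
    (forall y, D 0 (h 0 y) = y - mact (v 0 y) (u 0) 0) /\
    forall n y, D n.+1 (h n.+1 y) = y - mact (v n.+1 y) (u n.+1) 0 - h n (D n y).
Proof.
move=> u0 Du v0 vD.
pose gf n (y : P n) := y - mact (v n y) (u n) 0.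
have gl n : linear (gf n).
  move=> r y y'; rewrite /gf linearP scalerBr addrACA -opprD; congr (_ - _).
  rewrite mactDl; congr (_ + _); rewrite /mact scaler_sumr.
  by apply: eq_bigr => k _; rewrite mxE scalerA.
pose g n := HB.pack_for {linear P n -> P n} (gf n)
  (GRing.isLinear.Build R _ _ _ (gf n) (gl n)).
have Dg n y : D n (g n.+1 y) = g n (D n y).
  rewrite /= /gf linearB mact_linear; congr (_ - _); rewrite -vD mactM.
  by apply: eq_bigr => k _; rewrite Du.
have [y|h0 h0E] := projective_lift (d := D 0) (f := g 0) (@res_projective _ _ P 0).
  apply/res_exact0; rewrite /= /gf linearB mact_linear /mact big_ord1 u0 v0 subrr //.
have [z|n h hh|h [h_0 hh]] := dependent_choice (T := fun n => {linear P n -> P n.+1})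
  (P := fun n h => forall z, D n (g n.+1 z - h (D n z)) = 0)
  (Q := fun n h h' => forall y, D n.+1 (h' y) = g n.+1 y - h (D n y)) (t0 := h0).
- by rewrite linearB Dg h0E subrr.
- have [y|h' h'E] := projective_lift (d := D n.+1) (f := g n.+1 \- (h \o D n))
    (@res_projective _ _ P n.+1).
    by apply/res_exact; apply: hh.
  exists h'; split=> // z; rewrite linearB Dg [X in _ - X]h'E /=.
  have DD : D n (D n.+1 z) = 0 by apply/res_exact; exists z.
  by rewrite DD linear0 subr0 subrr.
exists h; split=> [y|n y]; first by rewrite h_0; apply: h0E.
exact: (hh n).2.
Qed.

End Comparison.

(** * Vanishing of the maps induced on Ext *)

Section Vanishing.
Variables (R : comNzRingType) (m : idealr R) (hR : local_ring m).
Hypothesis hsing : ~ regular_local_ring m.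

Lemma singular_nontrivial_syzygy (b : nat -> nat)
    (d : forall n, 'M[R]_(rank_of b n.+1, rank_of b n)) :
  minimal_resolution m d -> exists c : 'rV_(b 0), syzygy (d 0) c /\
    ~ trivial_mod_m m (d 0) c.
Proof.
move=> hd; apply: contrapT => noc; apply: hsing.
apply: (regular_of_trivial_syzygies hR (x := d 0)) => [r|v vd j|v vd].
- split=> [mr|[v ->]].
    have [|v vE] := minimal_aug hd (A := const_mx r : 'M_1); first by move=> i j; rewrite mxE.
    by exists v; rewrite vE mxE.
  by apply: (in_ideal_mull hR); apply: (minimal_diff hd).
- have [B <-] := minimal_exact hd (n := 0) vd.
  by apply: (in_ideal_mull hR); apply: (minimal_diff hd).
- by apply: contrapT => nv; apply: noc; exists v.
Qed.

(** The cocycle that corresponds to [phi] on the minimal resolution has values in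
    [m F], which [g] kills; the homotopy between [P] and the minimal resolution
    provides the cochain whose coboundary is [g phi]. *)
Lemma comp_cocycle_coboundary (P : proj_resolution (residue_field m))
    (F V : lmodType R) (g : {linear F -> V}) n (phi : cocycle P F n) :
    (forall (r : R) (v : V), r \in m -> r *: v = 0) -> finite_proj_dim F ->
  comp_cocycle g phi \in @is_coboundary R _ P V n.
Proof.
move=> hV fpdF; have /asboolP[lphi dphi] := cocycleP phi.
pose f := HB.pack_for {linear P n -> F} (cocycle_fun phi)
  (GRing.isLinear.Build R _ _ _ (cocycle_fun phi) lphi).
have fd y : f (res_diff P n y) = 0 by apply: dphi.
have [b [d hd]] := exists_minimal_resolution hR.
have [c [syz_c nc]] := singular_nontrivial_syzygy hd.
have [theta [theta_chain theta_surj]] := exists_surjective_degree2_operator hR hd syz_c nc.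
have [N torF] := finite_proj_dim_tor_vanishes hd fpdF.
have [u [u0 Du]] := exists_comparison_to hd P.
have [v [v0 vD]] := exists_comparison_from hd P.
have [h [h0 hh]] := exists_comparison_homotopy u0 Du v0 vD.
have gfu k : g (f (u n k)) = 0.
  have [|w ->] := cocycle_in_mM hR hd theta_chain theta_surj torF
    (f := fun k => f (u n k)) _ k.
    by move=> j; rewrite -mact_linear -Du fd.
  rewrite mact_linear /mact big1 // => i _; rewrite mxE; apply: hV.
  exact: (minimal_diff hd).
have gfm (w : 'rV_(_)) : g (f (mact w (u n) 0)) = 0.
  by rewrite mact_linear mact_linear /mact big1 // => k _; rewrite gfu scaler0.
have gfE y : g (phi y) = g (f (mact (v n y) (u n) 0)) + g (f (y - mact (v n y) (u n) 0)).
  by rewrite -linearD -linearD addrC subrK.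
case: n phi lphi dphi @f fd gfu gfm gfE => [|n] phi lphi dphi f fd gfu gfm gfE.
  by apply/asboolP => y /=; rewrite gfE gfm add0r -h0 fd linear0.
apply/asboolP; exists (g \o f \o h n) => y /=; rewrite gfE gfm add0r.
rewrite -(subrK (h n (res_diff P n y)) (y - _)) -hh [f (_ + _)]linearD fd add0r.
by [].
Qed.

End Vanishing.

Theorem theorem2p1 (R : comNzRingType) (m : idealr R)
    (hR : local_ring m) (hsing : ~ regular_local_ring m)
    (V : lmodType R) (hV : forall (a : R) (v : V), a \in m -> a *: v = 0)
    (M : lmodType R) (beta : {linear M -> V})
    (hbeta : factors_through_finite_proj_dim beta)
    (P : proj_resolution (residue_field m)) (n : int) :
  forall x : ext P n M, ext_map P beta n x = 0.
Proof.
case: n => [n|n] x //=; have [F [f [g [fpdF betaE]]]] := hbeta.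
rewrite /ext_nat_map.
have -> : comp_cocycle beta (repr x) = comp_cocycle g (comp_cocycle f (repr x)).
  by apply/val_inj/funext => y /=; rewrite betaE.
have <- : quot_class (@is_coboundary R _ P V n) 0 = 0.
  by rewrite -[X in quot_class _ X](scale0r 0) quot_classZ scale0r.
apply/quot_classP; rewrite subr0.
exact: (comp_cocycle_coboundary hR hsing).
Qed.
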